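(* Let $T$ be a c.n.u. contraction on $H$ and $\mathcal{B}_T=A_T^{\perp_s}/A_T$ with its quotient strong symplectic structure. For $\lambda\in\mathbb{D}_+\cup\mathbb{D}_-$ let $W_T(\lambda)$ be the image of $N_\lambda$ under the quotient map $A_T^{\perp_s}\to\mathcal{B}_T$. Then $W_T(\lambda)\in W_+(\mathcal{B}_T)$ for $\lambda\in\mathbb{D}_+$, $W_T(\lambda)\in W_-(\mathcal{B}_T)$ for $\lambda\in\mathbb{D}_-$, the map $W_T:\mathbb{D}_+\cup\mathbb{D}_-\to W_+(\mathcal{B}_T)\cup W_-(\mathcal{B}_T)$ is holomorphic, and $W_T(\bar\lambda)=(W_T(\lambda))^{\perp_s}$ for every $\lambda\in\mathbb{D}_+$, where $\bar\lambda$ is regarded as a point of $\mathbb{D}_-$.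
   Context: $H$ is an infinite-dimensional separable complex Hilbert space; $T\in\mathbb{B}(H)$, $\|T\|\le1$, is completely non-unitary (no nonzero invariant subspace on which $T$ is unitary). $\mathbb{K}=\ker(I-T^*T)$. $\mathbb{H}=H\oplus_\perp H$ with $[(x_1,x_2),(y_1,y_2)]=i(x_1,y_1)_H-i(x_2,y_2)_H$; $S^{\perp_s}=\{a:[a,b]=0\ \forall b\in S\}$; $A_T=\{(x,Tx):x\in\mathbb{K}\}$, which is isotropic. The quotient $A_T^{\perp_s}/A_T$ carries the quotient Hilbert structure and the strong symplectic form $[[x],[y]]=[x,y]$. $\mathbb{D}_+$ and $\mathbb{D}_-$ are two copies of the open unit disc; $\mathbb{D}_-$ is identified with $(\mathbb{C}\setminus\overline{\mathbb{D}})\cup\{\infty\}$ via $\lambda\mapsto1/\lambda$. For $\lambda\in\mathbb{D}_\pm$, $\bar\lambda$ (complex conjugate of the coordinate) is regarded as a point of $\mathbb{D}_\mp$. Define $N_\lambda=\{(x,\lambda x):x\in H\}\cap A_T^{\perp_s}$ for $\lambda\in\mathbb{D}_+$ and $N_\lambda=\{(\lambda x,x):x\in H\}\cap A_T^{\perp_s}$ for $\lambda\in\mathbb{D}_-$. For a strong symplectic Hilbert space $\mathcal{B}$, $W_+(\mathcal{B})$ (resp. $W_-(\mathcal{B})$) is the set of maximally completely positive- (resp. negative-) definite subspaces: closed subspaces $L$, maximal with $-i[x,x]>0$ (resp. $i[x,x]>0$) for $x\ne0$, and with $\pm(-i[x,x])\ge c\|x\|^2$ on $L$ for some $c>0$.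 Complex structure: fixing $L\in W_+(\mathcal{B})$ (so $\mathcal{B}=L\oplus L^{\perp_s}$), each $W\in W_+(\mathcal{B})$ is uniquely $\{x+Cx:x\in L\}$ with $C\in\mathbb{B}(L,L^{\perp_s})$, $\|C\|<1$ (norms from $-i[\cdot,\cdot]$ on $L$ and $i[\cdot,\cdot]$ on $L^{\perp_s}$), and each $W\in W_-(\mathcal{B})$ is uniquely $\{Dy+y:y\in L^{\perp_s}\}$ with $D\in\mathbb{B}(L^{\perp_s},L)$, $\|D\|<1$; a map into $W_\pm(\mathcal{B})$ is holomorphic if these operator parameters depend holomorphically on the variable. *)

(* Defs.v *)
(* complex scalars are  R[i]  (mathcomp-real-closed) for  R : realType. *)
From mathcomp Require Import all_boot all_order all_algebra.
From mathcomp Require Import reals.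
From mathcomp.real_closed Require Import complex.
Set Implicit Arguments. Unset Strict Implicit. Unset Printing Implicit Defensive.
Import Order.TTheory GRing.Theory Num.Theory.
Local Open Scope ring_scope.

(* Complex Hilbert spaces, presented by an inner product on an lmodType *)

(* Subsets of a type, as predicates. *)
Definition subset_of (T : Type) (A B : T -> Prop) := forall x, A x -> B x.

(* ip is a (complex) inner product: linear in the first argument,
   Hermitian (hence conjugate-linear in the second), positive definite. *)
Definition is_inner (R : realType) (E : lmodType R[i]) (ip : E -> E -> R[i]) :=
  [/\ (forall (a : R[i]) x y z, ip (a *: x + y) z = a * ip x z + ip y z),
      (forall x y, ip x y = (ip y x)^*),
      (forall x, 0 <= ip x x) &
      (forall x, ip x x = 0 -> x = 0)].

(* the induced norm (a nonnegative real number, living in R[i]) *)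
Definition hnorm (R : realType) (E : lmodType R[i]) (ip : E -> E -> R[i]) (x : E)
  : R[i] := sqrtC (ip x x).

Definition seq_converges (R : realType) (E : lmodType R[i]) (ip : E -> E -> R[i])
  (u : nat -> E) (l : E) :=
  forall eps : R[i], 0 < eps -> exists N : nat, forall n, (N <= n)%N ->
    hnorm ip (u n - l) < eps.

Definition seq_cauchy (R : realType) (E : lmodType R[i]) (ip : E -> E -> R[i])
  (u : nat -> E) :=
  forall eps : R[i], 0 < eps -> exists N : nat, forall m n, (N <= m)%N -> (N <= n)%N ->
    hnorm ip (u m - u n) < eps.

(* complex Hilbert space: inner product space which is complete *)
Definition is_hilbert (R : realType) (E : lmodType R[i]) (ip : E -> E -> R[i]) :=
  is_inner ip /\
  forall u : nat -> E, seq_cauchy ip u -> exists l, seq_converges ip u l.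

(* separable: there is a countable dense subset *)
Definition separable (R : realType) (E : lmodType R[i]) (ip : E -> E -> R[i]) :=
  exists d : nat -> E, forall (x : E) (eps : R[i]), 0 < eps ->
    exists n, hnorm ip (x - d n) < eps.

(* infinite-dimensional: no finite family spans E *)
Definition infinite_dim (R : realType) (E : lmodType R[i]) :=
  forall s : seq E, exists x : E,
    ~ exists c : seq R[i], x = \sum_(k < size s) c`_k *: s`_k.

(* linear subspaces and closed subspaces *)
Definition lin_subspace (R : realType) (E : lmodType R[i]) (S : E -> Prop) :=
  S 0 /\ forall (a : R[i]) x y, S x -> S y -> S (a *: x + y).

Definition closed_subspace (R : realType) (E : lmodType R[i]) (ip : E -> E -> R[i])
  (S : E -> Prop) :=
  lin_subspace S /\
  forall (u : nat -> E) (l : E), (forall n, S (u n)) -> seq_converges ip u l -> S l.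

(* Operators on H                                                       *)

Definition bounded_linear (R : realType) (E : lmodType R[i]) (ip : E -> E -> R[i])
  (T : E -> E) :=
  (forall (a : R[i]) x y, T (a *: x + y) = a *: T x + T y) /\
  exists M : R[i], forall x, hnorm ip (T x) <= M * hnorm ip x.

(* Ts is the Hilbert-space adjoint T^* of T *)
Definition is_adjoint (R : realType) (E : lmodType R[i]) (ip : E -> E -> R[i])
  (T Ts : E -> E) :=
  forall x y, ip (T x) y = ip x (Ts y).

(* ||T|| <= 1 *)
Definition contraction (R : realType) (E : lmodType R[i]) (ip : E -> E -> R[i])
  (T : E -> E) := forall x, hnorm ip (T x) <= hnorm ip x.

(* completely non-unitary: the only closed subspace M invariant under T
   on which T is unitary (isometric and onto M) is {0} *)
Definition completely_non_unitary (R : realType) (E : lmodType R[i])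
  (ip : E -> E -> R[i]) (T : E -> E) :=
  forall M : E -> Prop, closed_subspace ip M ->
    (forall x, M x -> M (T x)) ->
    (forall x, M x -> hnorm ip (T x) = hnorm ip x) ->
    (forall y, M y -> exists x, M x /\ T x = y) ->
    forall x, M x -> x = 0.

(* The space  HH = H (+) H  with its Hilbert and symplectic structures  *)

(* Hilbert inner product of H (+)_perp H *)
Definition ip2 (R : realType) (H : lmodType R[i]) (ip : H -> H -> R[i])
  (a b : (H * H)%type) : R[i] := ip a.1 b.1 + ip a.2 b.2.

(* [(x1,x2),(y1,y2)] = i(x1,y1) - i(x2,y2) *)
Definition sform (R : realType) (H : lmodType R[i]) (ip : H -> H -> R[i])
  (a b : (H * H)%type) : R[i] := 'i * ip a.1 b.1 - 'i * ip a.2 b.2.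

(* symplectic complement of S inside an ambient set Amb *)
Definition s_orth_in (R : realType) (E : lmodType R[i]) (sf : E -> E -> R[i])
  (Amb S : E -> Prop) : E -> Prop :=
  fun a => Amb a /\ forall b, S b -> sf a b = 0.

(* Hilbert orthogonal complement of S *)
Definition h_orth (R : realType) (E : lmodType R[i]) (ip : E -> E -> R[i])
  (S : E -> Prop) : E -> Prop :=
  fun a => forall b, S b -> ip a b = 0.

Definition whole (T : Type) : T -> Prop := fun _ => True.

(* K = ker (I - T^* T) *)
Definition kerK (R : realType) (H : lmodType R[i]) (T Ts : H -> H) : H -> Prop :=
  fun x => x - Ts (T x) = 0.

(* A_T = {(x, T x) : x in K} *)
Definition A_T (R : realType) (H : lmodType R[i]) (T Ts : H -> H)
  : (H * H)%type -> Prop :=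
  fun a => exists x, kerK T Ts x /\ a = (x, T x).

(* A_T^{perp_s} *)
Definition As_T (R : realType) (H : lmodType R[i]) (ip : H -> H -> R[i])
  (T Ts : H -> H) : (H * H)%type -> Prop :=
  s_orth_in (sform ip) (@whole _) (A_T T Ts).

(* Model of the quotient  B_T = A_T^{perp_s} / A_T : each class [n] (n in
   A_T^{perp_s}) is represented by its unique representative orthogonal
   (in the Hilbert sense) to A_T.  This is the standard isometric
   identification of the quotient Hilbert space with the orthogonal
   complement of A_T in A_T^{perp_s}; it carries the inner product ip2 and
   the form sform, which realises [[ [x],[y] ]] = [x,y]. *)
Definition B_T (R : realType) (H : lmodType R[i]) (ip : H -> H -> R[i])
  (T Ts : H -> H) : (H * H)%type -> Prop :=
  fun a => As_T ip T Ts a /\ h_orth (ip2 ip) (A_T T Ts) a.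

(* image of a subset S of A_T^{perp_s} under the quotient map *)
Definition quot_image (R : realType) (H : lmodType R[i]) (ip : H -> H -> R[i])
  (T Ts : H -> H) (S : (H * H)%type -> Prop) : (H * H)%type -> Prop :=
  fun b => B_T ip T Ts b /\ exists n, S n /\ A_T T Ts (n - b).

(* N_lambda for lambda in D_+  (coordinate lambda, |lambda| < 1) *)
Definition N_plus (R : realType) (H : lmodType R[i]) (ip : H -> H -> R[i])
  (T Ts : H -> H) (l : R[i]) : (H * H)%type -> Prop :=
  fun a => (exists x, a = (x, l *: x)) /\ As_T ip T Ts a.

(* N_lambda for lambda in D_-  (disc coordinate lambda, |lambda| < 1,
   corresponding to the point 1/lambda of the exterior of the disc) *)
Definition N_minus (R : realType) (H : lmodType R[i]) (ip : H -> H -> R[i])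
  (T Ts : H -> H) (l : R[i]) : (H * H)%type -> Prop :=
  fun a => (exists x, a = (l *: x, x)) /\ As_T ip T Ts a.

Definition W_T_plus (R : realType) (H : lmodType R[i]) (ip : H -> H -> R[i])
  (T Ts : H -> H) (l : R[i]) := quot_image ip T Ts (N_plus ip T Ts l).

Definition W_T_minus (R : realType) (H : lmodType R[i]) (ip : H -> H -> R[i])
  (T Ts : H -> H) (l : R[i]) := quot_image ip T Ts (N_minus ip T Ts l).

(* Maximal completely positive/negative definite subspaces of a strong  *)
(* symplectic Hilbert space, given as a subset B of E with inner        *)
(* product ipE and symplectic form sf                                  *)

Definition pos_definite (R : realType) (E : lmodType R[i]) (sf : E -> E -> R[i])
  (L : E -> Prop) := forall x, L x -> x <> 0 -> 0 < - 'i * sf x x.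

Definition neg_definite (R : realType) (E : lmodType R[i]) (sf : E -> E -> R[i])
  (L : E -> Prop) := forall x, L x -> x <> 0 -> 0 < 'i * sf x x.

Definition W_plus (R : realType) (E : lmodType R[i]) (ipE sf : E -> E -> R[i])
  (B L : E -> Prop) :=
  [/\ closed_subspace ipE L, subset_of L B, pos_definite sf L,
      (forall L' : E -> Prop, lin_subspace L' -> subset_of L' B -> subset_of L L' ->
          pos_definite sf L' -> subset_of L' L) &
      exists c : R[i], 0 < c /\
        forall x, L x -> c * hnorm ipE x ^+ 2 <= - 'i * sf x x].

Definition W_minus (R : realType) (E : lmodType R[i]) (ipE sf : E -> E -> R[i])
  (B L : E -> Prop) :=
  [/\ closed_subspace ipE L, subset_of L B, neg_definite sf L,
      (forall L' : E -> Prop, lin_subspace L' -> subset_of L' B -> subset_of L L' ->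
          neg_definite sf L' -> subset_of L' L) &
      exists c : R[i], 0 < c /\
        forall x, L x -> c * hnorm ipE x ^+ 2 <= 'i * sf x x].

Definition open_disc (R : realType) : R[i] -> Prop := fun l => `|l| < 1.

(* Holomorphic dependence of the operator parameter: W l = {x + C(l) x : x in P}
   with C(l) a bounded operator P -> Q, and l |-> C(l) complex (Frechet)
   differentiable in operator norm at every point of the domain dom. *)
Definition holomorphic_param (R : realType) (E : lmodType R[i]) (ipE : E -> E -> R[i])
  (P Q : E -> Prop) (W : R[i] -> E -> Prop) (dom : R[i] -> Prop) :=
  exists Cf : R[i] -> E -> E,
  [/\ (forall l, dom l -> forall x, P x -> Q (Cf l x)),
      (forall l, dom l -> forall (a : R[i]) x y, P x -> P y ->
          Cf l (a *: x + y) = a *: Cf l x + Cf l y),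
      (forall l, dom l -> exists M : R[i], forall x, P x ->
          hnorm ipE (Cf l x) <= M * hnorm ipE x),
      (forall l, dom l -> forall y, W l y <-> exists x, P x /\ y = x + Cf l x) &
      (forall l0, dom l0 -> exists D : E -> E,
         [/\ (forall x, P x -> Q (D x)),
             (forall (a : R[i]) x y, P x -> P y -> D (a *: x + y) = a *: D x + D y),
             (exists M : R[i], forall x, P x -> hnorm ipE (D x) <= M * hnorm ipE x) &
             (forall eps : R[i], 0 < eps -> exists del : R[i], 0 < del /\
                forall l, dom l -> `|l - l0| < del -> forall x, P x ->
                  hnorm ipE (Cf l x - Cf l0 x - (l - l0) *: D x)
                    <= eps * `|l - l0| * hnorm ipE x)])].

(* Main.v *)
(* Idea. Let P be the orthogonal projection onto K = ker (1 - T^* T), V = T P and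
   S = V^* = P T^*. V is a partial isometry with initial space K, and B_T is the product
   of ker V and ker S. The image of N_l in B_T is the graph over ker V of
   l (1 - V S) (1 - l S)^-1, and (u, v) = (x - l S x, l (x - V S x)) satisfies
   |u|^2 - |v|^2 = (1 - |l|^2) |x|^2, which makes the subspace uniformly positive.
   D_- is obtained by exchanging V and S, and duality follows from the two graphs being
   orthogonal for the form and surjecting onto ker V and ker S. For a general base point
   L0, the parameter is the graph function relative to L0 + L0^perp; its differences are
   governed by the divided difference of the transfer function, by the resolvent
   identity. All estimates are made with the real part of the inner product. *)
Require Import Defs.
From mathcomp Require Import all_boot all_order all_algebra.
From mathcomp Require Import ring lra.
From mathcomp Require Import boolp classical_sets reals.
From mathcomp.real_closed Require Import complex.
Set Implicit Arguments. Unset Strict Implicit. Unset Printing Implicit Defensive.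
Import Order.TTheory GRing.Theory Num.Theory.
Local Open Scope ring_scope.

(** The projection onto K, the projection onto L0 along its form complement, the resolvent of S and
    the solvability of [P w = x] on each subspace all come from one principle: minimisation of a
    real quadratic form that is coercive on a closed subspace. Coercivity is asked on that subspace
    only, so the indefinite form is admissible. Working with real parts loses nothing, because
    complex subspaces are stable under multiplication by i, so that a real orthogonality relation is
    already a complex one.

    The obstacle in the holomorphy claim is that L0 is arbitrary: the transfer function is the
    parameter relative to ker V and ker S, whereas graphs over L0 are required. A fractional linear
    change of parameter would mean inverting operators. Instead the graph function is chosen
    pointwise, and a displacement along the divided difference is corrected by a point of the same
    subspace. This yields an exact formula for the increment of the graph function; using it twice
    gives the derivative with a quadratic remainder. *)

Section Modulus.
Context {R : realType}.
Implicit Types z w : R[i].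

(** The norm of [R[i]] takes values in [R[i]]; this copy in [R] keeps all estimates in an ordered
    field. *)
Definition cabs z : R := complex.Re `|z|.

Lemma norm_cabs z : `|z| = (cabs z)%:C%C.
Proof. by rewrite /cabs normc_def. Qed.

Lemma cabs_ge0 z : 0 <= cabs z.
Proof. by rewrite -ler0c -norm_cabs. Qed.

Lemma cabsD z w : cabs (z + w) <= cabs z + cabs w.
Proof. by rewrite -lecR rmorphD /= -!norm_cabs ler_normD. Qed.

Lemma cabsJ z : cabs z^* = cabs z.
Proof. by apply: complexI; rewrite -!norm_cabs norm_conjC. Qed.

Lemma cabs_sqr z : (cabs z ^+ 2)%:C%C = z * z^*.
Proof. by rewrite rmorphXn /= -norm_cabs normCK. Qed.

Lemma pos_real z : 0 < z -> exists2 a : R, 0 < a & z = a%:C%C.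
Proof.
move=> z0; have /complex_realP [a za] : z \is Num.real by rewrite realE ltW.
by exists a => //; rewrite -ltcR -za.
Qed.

Lemma complex_ReJ z : complex.Re z^* = complex.Re z.
Proof. by case: z. Qed.

Lemma complex_ReMi z : complex.Re ('i * z) = - complex.Im z.
Proof. by rewrite -complexiE mulrC ReiNIm. Qed.

Lemma complex_ReD z w : complex.Re (z + w) = complex.Re z + complex.Re w.
Proof. by case: z; case: w. Qed.

Lemma complex_ReZ (a : R) z : complex.Re (a%:C%C * z) = a * complex.Re z.
Proof. by case: z => x y /=; rewrite mul0r subr0. Qed.

End Modulus.

(** * Real geometry of a complex inner product *)

Section InnerProduct.
Context {R : realType} {E : lmodType R[i]} {ip : E -> E -> R[i]}.
Hypothesis ipP : is_inner ip.
Implicit Types (x y z : E) (a : R[i]).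

Definition rip (ip : E -> E -> R[i]) x y : R := complex.Re (ip x y).
Definition rnm (ip : E -> E -> R[i]) x : R := Num.sqrt (rip ip x x).

Local Notation r := (rip ip).
Local Notation N := (rnm ip).

Lemma ipDl x y z : ip (x + y) z = ip x z + ip y z.
Proof. by case: ipP => lin _ _ _; have := lin 1 x y z; rewrite scale1r mul1r. Qed.

Lemma ip0l z : ip 0 z = 0.
Proof. by apply: (addrI (ip 0 z)); rewrite -ipDl !addr0. Qed.

Lemma ipZl a x z : ip (a *: x) z = a * ip x z.
Proof. by case: ipP => lin _ _ _; have := lin a x 0 z; rewrite !addr0 ip0l addr0. Qed.

Lemma ripC x y : r x y = r y x.
Proof. by case: ipP => _ h _ _; rewrite /rip h complex_ReJ. Qed.

Lemma ripDl x y z : r (x + y) z = r x z + r y z.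
Proof. by rewrite /rip ipDl complex_ReD. Qed.

Lemma ripZ (a : R) x z : r (a%:C%C *: x) z = a * r x z.
Proof. by rewrite /rip ipZl complex_ReZ. Qed.

Lemma ripNl x z : r (- x) z = - r x z.
Proof. by rewrite -mulN1r -ripZ rmorphN1 scaleN1r. Qed.

Lemma ripBl x y z : r (x - y) z = r x z - r y z.
Proof. by rewrite ripDl ripNl. Qed.

Lemma ripDr x y z : r z (x + y) = r z x + r z y.
Proof. by rewrite ![r z _]ripC ripDl. Qed.

Lemma ripNr x z : r z (- x) = - r z x.
Proof. by rewrite ![r z _]ripC ripNl. Qed.

Lemma ripBr x y z : r z (x - y) = r z x - r z y.
Proof. by rewrite ripDr ripNr. Qed.

Lemma ripZr (a : R) x z : r z (a%:C%C *: x) = a * r z x.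
Proof. by rewrite ![r z _]ripC ripZ. Qed.

Lemma rip0l z : r 0 z = 0.
Proof. by rewrite /rip ip0l. Qed.

Lemma rip0r z : r z 0 = 0.
Proof. by rewrite ripC rip0l. Qed.

Lemma rip_ge0 x : 0 <= r x x.
Proof. by case: ipP => _ _ h _; have := h x; rewrite lecE => /andP[]. Qed.

Lemma rip_self x : ip x x = (r x x)%:C%C.
Proof. by case: ipP => _ _ h _; rewrite /rip RRe_real// ger0_real. Qed.

Lemma rip_eq0 x : r x x = 0 -> x = 0.
Proof. by move=> rx; case: ipP => _ _ _; apply; rewrite rip_self rx. Qed.

Lemma rip_adj a x y : r (a *: x) y = r x (a^* *: y).
Proof.
case: ipP => _ h _ _; rewrite /rip ipZl [ip x (_ *: _)]h ipZl rmorphM /= conjCK.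
by rewrite -h.
Qed.

Lemma rip_scale a x y : r (a *: x) (a *: y) = cabs a ^+ 2 * r x y.
Proof. by rewrite rip_adj scalerA mulrC -cabs_sqr ripZr. Qed.

Lemma rnm_ge0 x : 0 <= N x. Proof. exact: sqrtr_ge0. Qed.

Lemma rnm_sqr x : N x ^+ 2 = r x x. Proof. by rewrite sqr_sqrtr ?rip_ge0. Qed.

Lemma rnm_eq0 x : N x = 0 -> x = 0.
Proof. by move=> nx; apply: rip_eq0; rewrite -rnm_sqr nx expr0n. Qed.

Lemma rnm_gt0 x : x <> 0 -> 0 < N x.
Proof. by move=> x0; rewrite lt0r rnm_ge0 andbT; apply/eqP => /rnm_eq0. Qed.

Lemma rnm0 : N 0 = 0. Proof. by rewrite /rnm rip0l sqrtr0. Qed.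

Lemma hnormE x : hnorm ip x = (N x)%:C%C.
Proof.
rewrite /hnorm rip_self -rnm_sqr rmorphXn /= sqrCK// ler0c; exact: rnm_ge0.
Qed.

Lemma rnmZ a x : N (a *: x) = cabs a * N x.
Proof.
by rewrite /rnm rip_scale sqrtrM ?sqr_ge0// sqrtr_sqr ger0_norm ?cabs_ge0.
Qed.

Lemma rnmN x : N (- x) = N x.
Proof. by rewrite /rnm ripNl ripNr opprK. Qed.

Lemma rnmB_sym x y : N (x - y) = N (y - x).
Proof. by rewrite -rnmN opprB. Qed.

Lemma cauchy_schwarz x y : r x y <= N x * N y.
Proof.
have [->|/eqP y0] := eqVneq y 0; first by rewrite rip0r mulr_ge0 ?rnm_ge0.
have [->|/eqP x0] := eqVneq x 0; first by rewrite rip0l mulr_ge0 ?rnm_ge0.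
(* The squared norm of this vector is 2 st (st - r x y) with st = [N x * N y]. *)
have := rip_ge0 ((N y)%:C%C *: x - (N x)%:C%C *: y).
rewrite !(ripBl, ripBr, ripZ, ripZr) -!rnm_sqr (ripC y x).
have := mulr_gt0 (rnm_gt0 x0) (rnm_gt0 y0).
move: (N x) (N y) (r x y) => s t u st h.
by rewrite -subr_ge0 -(pmulr_rge0 _ st); nra.
Qed.

Lemma cauchy_schwarz_norm x y : `|r x y| <= N x * N y.
Proof.
by rewrite ler_norml cauchy_schwarz andbT lerNl -ripNl -(rnmN x) cauchy_schwarz.
Qed.

Lemma rnmD x y : N (x + y) <= N x + N y.
Proof.
rewrite -(@ler_pXn2r _ 2) ?nnegrE ?addr_ge0 ?rnm_ge0//.
rewrite rnm_sqr ripDl !ripDr -!rnm_sqr (ripC y x).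
by have := cauchy_schwarz x y; nra.
Qed.

Lemma rnmB x y : N (x - y) <= N x + N y.
Proof. by rewrite -(rnmN y) rnmD. Qed.

Lemma ip_eq0_Re x y : r x y = 0 -> r ('i *: x) y = 0 -> ip x y = 0.
Proof.
rewrite /rip ipZl complex_ReMi; case: (ip x y) => a b /= -> /eqP.
by rewrite oppr_eq0 => /eqP ->.
Qed.

End InnerProduct.

Section Convergence.
Context {R : realType} {E : lmodType R[i]} {ip : E -> E -> R[i]}.
Hypothesis ipP : is_inner ip.
Local Notation N := (rnm ip).

Lemma seq_convergesE u l : seq_converges ip u l <->
  forall e : R, 0 < e -> exists n0, forall n, (n0 <= n)%N -> N (u n - l) < e.
Proof.
split=> h e e0.
  have [|n0 hn0] := h e%:C%C; first by rewrite ltcR.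
  by exists n0 => n /hn0; rewrite (hnormE ipP) ltcR.
have [a a0 ->] := pos_real e0; have [n0 hn0] := h a a0.
by exists n0 => n /hn0; rewrite (hnormE ipP) ltcR.
Qed.

Lemma seq_cauchyE u : seq_cauchy ip u <->
  forall e : R, 0 < e -> exists n0, forall m n, (n0 <= m)%N -> (n0 <= n)%N ->
    N (u m - u n) < e.
Proof.
split=> h e e0.
  have [|n0 hn0] := h e%:C%C; first by rewrite ltcR.
  by exists n0 => m n hm hn; have := hn0 _ _ hm hn; rewrite (hnormE ipP) ltcR.
have [a a0 ->] := pos_real e0; have [n0 hn0] := h a a0.
by exists n0 => m n hm hn; have := hn0 _ _ hm hn; rewrite (hnormE ipP) ltcR.
Qed.

End Convergence.

Section Subspaces.
Context {R : realType} {E : lmodType R[i]} {L : E -> Prop}.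
Hypothesis LP : lin_subspace L.

Lemma subspaceZ (a : R[i]) x : L x -> L (a *: x).
Proof. by move=> Lx; rewrite -[_ *: _]addr0; apply: LP.2 => //; apply: LP.1. Qed.

Lemma subspaceD x y : L x -> L y -> L (x + y).
Proof. by move=> Lx Ly; rewrite -[x]scale1r; apply: LP.2. Qed.

Lemma subspaceB x y : L x -> L y -> L (x - y).
Proof. by move=> Lx Ly; apply: subspaceD => //; rewrite -scaleN1r; apply: subspaceZ. Qed.

(** [L] contains i b along with b, and the real products with b and i b determine the complex
    one. *)
Lemma ip_orthE (ip : E -> E -> R[i]) a : is_inner ip ->
  (forall b, L b -> ip a b = 0) <-> (forall b, L b -> rip ip b a = 0).
Proof.
move=> ipP; have [_ herm _ _] := ipP; split=> h b Lb.
  by rewrite (ripC ipP) /rip h.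
rewrite herm (ip_eq0_Re ipP (h _ Lb)) ?conjC0//.
by apply: h; apply: subspaceZ.
Qed.

End Subspaces.

Section RealForms.
Context {R : realType} {E : lmodType R[i]}.

Definition real_functional (phi : E -> R) :=
  (forall x y, phi (x + y) = phi x + phi y) /\
  (forall (a : R) x, phi (a%:C%C *: x) = a * phi x).

(** No positivity is asked, so that the inner product and the indefinite form [kform] are both
    instances. Real scalars act through their embedding in [R[i]]. *)
Definition real_form (b : E -> E -> R) :=
  (forall x y, b x y = b y x) /\ (forall y, real_functional (b^~ y)).

Context {b : E -> E -> R}.
Hypothesis bP : real_form b.

Lemma rformC x y : b x y = b y x. Proof. by case: bP. Qed.

Lemma rformDl x y z : b (x + y) z = b x z + b y z.
Proof. by case: bP => _ /(_ z)[]. Qed.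

Lemma rformZl (a : R) x z : b (a%:C%C *: x) z = a * b x z.
Proof. by case: bP => _ /(_ z)[]. Qed.

Lemma rformDr x y z : b z (x + y) = b z x + b z y.
Proof. by rewrite ![b z _]rformC rformDl. Qed.

Lemma rformZr (a : R) x z : b z (a%:C%C *: x) = a * b z x.
Proof. by rewrite ![b z _]rformC rformZl. Qed.

Lemma rformNl x z : b (- x) z = - b x z.
Proof. by rewrite -mulN1r -rformZl rmorphN1 scaleN1r. Qed.

Lemma rformNr x z : b z (- x) = - b z x.
Proof. by rewrite ![b z _]rformC rformNl. Qed.

Lemma rformBl x y z : b (x - y) z = b x z - b y z.
Proof. by rewrite rformDl rformNl. Qed.

Lemma rformBr x y z : b z (x - y) = b z x - b z y.
Proof. by rewrite ![b z _]rformC rformBl. Qed.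

Lemma real_formN : real_form (fun x y => - b x y).
Proof.
split=> [x y|y]; first by rewrite rformC.
by split=> [x z|a x]; rewrite ?rformDl ?rformZl ?opprD ?mulrN.
Qed.

End RealForms.

Lemma inv_nat_small (R : realType) (e : R) : 0 < e ->
  exists n0, forall n, (n0 <= n)%N -> n.+1%:R^-1 < e.
Proof.
move=> e0; exists (Num.truncn e^-1) => n hn.
rewrite invf_plt ?posrE ?ltr0Sn//.
by apply: lt_le_trans (truncnS_gt _) _; rewrite ler_nat ltnS.
Qed.

(** * Representation of functionals by coercive forms, and least squares *)

Section Riesz.
Context {R : realType} {E : lmodType R[i]} {ip : E -> E -> R[i]}.
Hypothesis ipP : is_hilbert ip.
Local Notation N := (rnm ip).

(* The solution minimises [b x x - 2 * phi x] on [L]; the parallelogram identity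
   makes minimising sequences Cauchy. *)
Lemma riesz_coercive (L : E -> Prop) (b : E -> E -> R) (phi : E -> R) (c C M : R) :
  closed_subspace ip L -> real_form b -> real_functional phi ->
  0 < c -> (forall x, L x -> c * N x ^+ 2 <= b x x) ->
  (forall x y, `|b x y| <= C * N x * N y) -> (forall x, `|phi x| <= M * N x) ->
  exists2 p, L p & forall x, L x -> b x p = phi x.
Proof.
move=> [LP Lcl] bP [phiD phiZ] c0 bc bC phiM.
have innP := ipP.1.
pose q x := b x x - 2 * phi x.
(* The bound is the minimum over t of c t^2 - 2 M t. *)
have q_lb x : L x -> - (M ^+ 2 / c) <= q x.
  move=> Lx; have /ler_normlP[_ h1] := phiM x; have h2 := bc x Lx.
  rewrite -subr_ge0 -(pmulr_rge0 _ c0) /q.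
  have -> : c * (b x x - 2 * phi x - - (M ^+ 2 / c)) =
            c * b x x - 2 * c * phi x + M ^+ 2 by field; rewrite gt_eqF.
  have : c * (c * N x ^+ 2) <= c * b x x by rewrite ler_pM2l.
  have : c * phi x <= c * (M * N x) by rewrite ler_pM2l.
  by have := sqr_ge0 (c * N x - M); nra.
pose A := [set q x | x in (L : set E)]%classic.
have lbA : has_lbound A by exists (- (M ^+ 2 / c)) => _ [x Lx <-]; exact: q_lb.
have infA : has_inf A by split=> //; exists (q 0); exists 0 => //; exact: LP.1.
pose m := inf A.
have m_le x : L x -> m <= q x by move=> Lx; apply: ge_inf => //; exists x.
have /choice[u uP] : forall n : nat, exists x, L x /\ q x < m + n.+1%:R^-1.
  move=> n.
  have [||_ [x Lx <-] hx] := @inf_adherent R A n.+1%:R^-1 => //; last by exists x.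
  by rewrite invr_gt0 ltr0Sn.
(* The midpoint z satisfies m <= q z, and b (x - y) (x - y) = 2 (q x + q y - 2 q z). *)
have par x y : L x -> L y -> c * N (x - y) ^+ 2 <= 2 * (q x + q y - 2 * m).
  move=> Lx Ly.
  have Lz : L ((2^-1)%:C%C *: (x + y)).
    by apply: subspaceZ => //; apply: subspaceD.
  have := bc _ (subspaceB LP Lx Ly); have := m_le _ Lz.
  rewrite /q !(rformZl bP, rformZr bP, rformDl bP, rformDr bP, rformNl bP, rformNr bP).
  by rewrite phiZ phiD (rformC bP y x); lra.
have [p pP] : exists p, seq_converges ip u p.
  apply: ipP.2; apply/(seq_cauchyE innP) => e e0.
  (* With both values of [q] within c e^2 / 4 of the infimum, [par] bounds c N^2 by c e^2. *)
  have ce0 : 0 < c * e ^+ 2 / 4 by rewrite divr_gt0 ?mulr_gt0 ?exprn_gt0.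
  have [n0 hn0] := inv_nat_small ce0.
  exists n0 => i j /hn0 hi /hn0 hj.
  have [Li qi] := uP i; have [Lj qj] := uP j; have := par _ _ Li Lj.
  rewrite -(@ltr_pXn2r _ 2) ?nnegrE ?rnm_ge0 ?(ltW e0)// -(ltr_pM2l c0).
  by move: i.+1%:R^-1 j.+1%:R^-1 hi hj qi qj => *; lra.
exists p; first by apply: Lcl pP => n; case: (uP n).
move=> x Lx; apply/eqP; rewrite -subr_eq0 -normr_eq0; apply/eqP.
have C0 : 0 <= C * N x * N x by apply: le_trans (bC x x).
pose K := C * N x * N x + 1; have K0 : 0 < K by rewrite /K; lra.
have step n : (b x (u n) - phi x) ^+ 2 < K * n.+1%:R^-1.
  have [Lu qu] := uP n; set d := b x (u n) - phi x.
  (* Since b x x < K, this displacement lowers [q] by at least d^2 / K, while [u n] is less than 1 /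
     (n + 1) above the infimum. *)
  have /m_le : L (u n + (- (d / K))%:C%C *: x).
    by apply: subspaceD => //; apply: subspaceZ.
  have /ler_normlP[_ bx] := bC x x.
  move: qu; rewrite /q !(rformDl bP, rformDr bP, rformZl bP, rformZr bP) phiD phiZ.
  rewrite (rformC bP (u n) x).
  have -> : b x (u n) = d + phi x by rewrite /d subrK.
  set e := n.+1%:R^-1 => h1 h2.
  have : 2 * (d / K) * d - (d / K) ^+ 2 * b x x < e by nra.
  rewrite -(ltr_pM2l K0).
  have -> : K * (2 * (d / K) * d - (d / K) ^+ 2 * b x x) =
      d ^+ 2 * ((2 * K - b x x) / K) by field; rewrite gt_eqF.
  apply: le_lt_trans; rewrite ler_peMr ?sqr_ge0//.
  by rewrite ler_pdivlMr// mul1r /K; lra.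
have [//|/eqP D0] := eqVneq `|b x p - phi x| 0.
have {}D0 : 0 < `|b x p - phi x| by rewrite lt0r normr_ge0 andbT; apply/eqP.
set D := `|b x p - phi x| in D0 *.
(* For large n both parts of D, the defect at [u n] and the change from [u n] to [p], fall below D /
   2. *)
have DK0 : 0 < (D / 2) ^+ 2 / K by rewrite divr_gt0 ?exprn_gt0 ?divr_gt0.
have [n1 h1] := inv_nat_small DK0.
have Cx0 : 0 < `|C| * N x + 1 by rewrite ltr_wpDl// mulr_ge0 ?rnm_ge0.
have [n2 h2] := (seq_convergesE innP u p).1 pP (D / 2 / (`|C| * N x + 1))
  ltac:(by rewrite !divr_gt0).
pose n := maxn n1 n2.
have := h1 n (leq_maxl _ _); rewrite ltr_pdivlMr// mulrC => h3.
have := lt_trans (step n) h3; rewrite -real_normK ?num_real//.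
rewrite ltr_pXn2r ?nnegrE ?divr_ge0 ?(ltW D0)// => h4.
have := h2 n (leq_maxr _ _); rewrite ltr_pdivlMr// => h5.
have h6 := bC x (p - u n); rewrite (rnmB_sym innP) in h6.
have h7 : D <= `|b x (u n) - phi x| + `|b x (p - u n)|.
  by rewrite /D -[b x p](subrK (b x (u n))) -(rformBr bP) -addrA addrC ler_normD.
have h8 : C * N x * N (u n - p) <= `|C| * N x * N (u n - p).
  by rewrite !ler_wpM2r ?rnm_ge0 ?ler_norm.
have : D < D by have := rnm_ge0 (u n - p) : 0 <= N (u n - p); clear h3; nra.
by rewrite ltxx.
Qed.

End Riesz.

Section LinearMaps.
Context {R : realType} {E F : lmodType R[i]} {f : E -> F}.
Hypothesis fP : linear f.

Lemma linD x y : f (x + y) = f x + f y.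
Proof. by have := fP 1 x y; rewrite !scale1r. Qed.

Lemma lin0 : f 0 = 0.
Proof. by apply: (addrI (f 0)); rewrite -linD !addr0. Qed.

Lemma linZ a x : f (a *: x) = a *: f x.
Proof. by have := fP a x 0; rewrite !addr0 lin0 addr0. Qed.

Lemma linN x : f (- x) = - f x.
Proof. by rewrite -scaleN1r linZ scaleN1r. Qed.

Lemma linB x y : f (x - y) = f x - f y.
Proof. by rewrite linD linN. Qed.

End LinearMaps.

Section LeastSquares.
Context {R : realType} {E F : lmodType R[i]}.
Context {ipE : E -> E -> R[i]} {ipF : F -> F -> R[i]}.
Hypotheses (ipEP : is_hilbert ipE) (ipFP : is_inner ipF).

(** The pullback of [k] by [f] is coercive on [L], and p represents the functional x -> k (f x) y
    for it. The form [k] may be indefinite away from the image of [L]. *)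
Lemma least_squares (L : E -> Prop) (f : E -> F) (k : F -> F -> R) (b c C : R) :
  closed_subspace ipE L -> linear f ->
  (forall x, rnm ipF (f x) <= b * rnm ipE x) ->
  real_form k -> 0 <= C -> (forall y z, `|k y z| <= C * rnm ipF y * rnm ipF z) ->
  0 < c -> (forall x, L x -> c * rnm ipE x ^+ 2 <= k (f x) (f x)) ->
  forall y, exists2 p, L p & forall x, L x -> k (f x) (y - f p) = 0.
Proof.
move=> LP fP fb kP C0 kC c0 kc y.
have [|||||||p Lp hp] := @riesz_coercive R E ipE ipEP L
   (fun x z => k (f x) (f z)) (fun x => k (f x) y) c (C * b * b) (C * b * rnm ipF y).
- exact: LP.
- split=> [x z|z]; first exact: (rformC kP).
  by split=> [x x'|a x]; rewrite ?(linD fP) ?(linZ fP) ?(rformDl kP) ?(rformZl kP).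
- by split=> [x x'|a x]; rewrite ?(linD fP) ?(linZ fP) ?(rformDl kP) ?(rformZl kP).
- exact: c0.
- exact: kc.
- move=> x z; apply: le_trans (kC _ _) _.
  have -> : C * b * b * rnm ipE x * rnm ipE z =
    C * (b * rnm ipE x) * (b * rnm ipE z) by ring.
  by rewrite !ler_pM ?mulr_ge0 ?rnm_ge0.
- move=> x; apply: le_trans (kC _ _) _.
  have -> : C * b * rnm ipF y * rnm ipE x =
    C * (b * rnm ipE x) * rnm ipF y by ring.
  by rewrite !ler_pM ?mulr_ge0 ?rnm_ge0.
exists p => // x Lx.
by rewrite (rformBr kP) hp// subrr.
Qed.

End LeastSquares.

(** * The product space with its inner product and its symplectic form *)

Section ProductSpace.
Context {R : realType} {H : lmodType R[i]} {ip : H -> H -> R[i]}.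
Hypothesis ipP : is_hilbert ip.
Local Notation HH := (H * H)%type.
Implicit Types a b : HH.

Lemma ip2_inner : is_inner (ip2 ip).
Proof.
have [lin herm pos def] := ipP.1; split.
- by move=> a x y z; rewrite /ip2 /= !lin; ring.
- by move=> x y; rewrite /ip2 rmorphD /= -!herm.
- by move=> x; rewrite addr_ge0.
- move=> [x y]; rewrite /ip2 /= => /eqP; rewrite paddr_eq0//.
  by case/andP => /eqP/def -> /eqP/def ->.
Qed.

Lemma rip2E a b : rip (ip2 ip) a b = rip ip a.1 b.1 + rip ip a.2 b.2.
Proof. by rewrite /rip complex_ReD. Qed.

Lemma rnm2_sqr a : rnm (ip2 ip) a ^+ 2 = rnm ip a.1 ^+ 2 + rnm ip a.2 ^+ 2.
Proof. by rewrite (rnm_sqr ip2_inner) rip2E -!(rnm_sqr ipP.1). Qed.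

Lemma rnm_fst a : rnm ip a.1 <= rnm (ip2 ip) a.
Proof.
by rewrite -(@ler_pXn2r _ 2) ?nnegrE ?rnm_ge0// rnm2_sqr lerDl sqr_ge0.
Qed.

Lemma rnm_snd a : rnm ip a.2 <= rnm (ip2 ip) a.
Proof.
by rewrite -(@ler_pXn2r _ 2) ?nnegrE ?rnm_ge0// rnm2_sqr lerDr sqr_ge0.
Qed.

Lemma rnm2_le a : rnm (ip2 ip) a <= rnm ip a.1 + rnm ip a.2.
Proof.
rewrite -(@ler_pXn2r _ 2) ?nnegrE ?addr_ge0 ?rnm_ge0// rnm2_sqr.
have := mulr_ge0 (rnm_ge0 (ip := ip) a.1) (rnm_ge0 (ip := ip) a.2); nra.
Qed.

Lemma ip2_hilbert : is_hilbert (ip2 ip).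
Proof.
split; first exact: ip2_inner.
move=> u /(seq_cauchyE ip2_inner) cu.
have [|x xP] := ipP.2 (fun n => (u n).1).
  apply/(seq_cauchyE ipP.1) => e /cu[n0 h]; exists n0 => m n hm hn.
  by apply: le_lt_trans (h _ _ hm hn); apply: (rnm_fst (u m - u n)).
have [|y yP] := ipP.2 (fun n => (u n).2).
  apply/(seq_cauchyE ipP.1) => e /cu[n0 h]; exists n0 => m n hm hn.
  by apply: le_lt_trans (h _ _ hm hn); apply: (rnm_snd (u m - u n)).
exists (x, y); apply/(seq_convergesE ip2_inner) => e e0.
have e20 : 0 < e / 2 by rewrite divr_gt0.
have [n1 h1] := (seq_convergesE ipP.1 _ _).1 xP _ e20.
have [n2 h2] := (seq_convergesE ipP.1 _ _).1 yP _ e20.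
exists (maxn n1 n2) => n; rewrite geq_max => /andP[/h1 k1 /h2 k2].
apply: le_lt_trans (rnm2_le _) _ => /=; lra.
Qed.

(* The real part of [-i[a, b]] for the symplectic form [sform]. *)
Definition kform (ip : H -> H -> R[i]) a b : R := rip ip a.1 b.1 - rip ip a.2 b.2.

Lemma kform_real_form : real_form (kform ip).
Proof.
have iP := ipP.1; split=> [x y|y].
  by rewrite /kform !(ripC iP _ y.1, ripC iP _ y.2).
by split=> [x z|a x]; rewrite /kform /= ?(ripDl iP) ?(ripZ iP); ring.
Qed.

(** Changing the sign of the second component of [b] is isometric and turns the form into the inner
    product. The factor 1 matches the shape of bound expected by [least_squares]. *)
Lemma kform_bound a b : `|kform ip a b| <= 1 * rnm (ip2 ip) a * rnm (ip2 ip) b.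
Proof.
have -> : kform ip a b = rip (ip2 ip) a (b.1, - b.2).
  by rewrite rip2E /= (ripNr ipP.1).
apply: le_trans (cauchy_schwarz_norm ip2_inner _ _) _.
suff -> : rnm (ip2 ip) (b.1, - b.2) = rnm (ip2 ip) b by rewrite mul1r.
by rewrite /rnm !rip2E /= (ripNl ipP.1) (ripNr ipP.1) opprK.
Qed.

Lemma kformE a : kform ip a a = rnm ip a.1 ^+ 2 - rnm ip a.2 ^+ 2.
Proof. by rewrite !(rnm_sqr ipP.1). Qed.

Lemma sform_i a b : - 'i * sform ip a b = ip a.1 b.1 - ip a.2 b.2.
Proof.
have i2 : 'i * 'i = -1 :> R[i] by rewrite -expr2 sqrCi.
rewrite /sform mulrBr !mulrA mulNr i2 opprK; ring.
Qed.

Lemma sform_self a : - 'i * sform ip a a = (kform ip a a)%:C%C.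
Proof. by rewrite sform_i !(rip_self ipP.1) rmorphB. Qed.

Lemma sform_eq0 a b : sform ip a b = 0 <-> ip a.1 b.1 = ip a.2 b.2.
Proof.
split=> h; last by rewrite /sform h subrr.
by apply/eqP; rewrite -subr_eq0 -sform_i h mulr0.
Qed.

Lemma sform_kform a b : sform ip a b = 0 -> kform ip a b = 0.
Proof. by move=> /sform_eq0 h; rewrite /kform /rip h subrr. Qed.

(** As for the inner product: testing with b and i b recovers the complex condition. *)
Lemma kform_orthE (S : HH -> Prop) a : lin_subspace S ->
  (forall b, S b -> sform ip a b = 0) <-> (forall b, S b -> kform ip b a = 0).
Proof.
move=> SP; split=> h b Sb.
  by rewrite (rformC kform_real_form); apply/sform_kform/h.
apply/sform_eq0; have [_ herm _ _] := ipP.1; rewrite !(herm a.1) !(herm a.2); congr (_^*).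
have h1 := h _ Sb; have h2 := h _ (subspaceZ SP 'i Sb).
apply/eqP; rewrite -subr_eq0; apply/eqP.
move: h1 h2; rewrite /kform /rip /= !(ipZl ipP.1) !complex_ReMi.
case: (ip b.1 _) (ip b.2 _) => [p q] [p' q'] /= h1 h2.
have -> : p = p' by lra.
have -> : q = q' by lra.
by rewrite !subrr.
Qed.

End ProductSpace.

(** * Holomorphic dependence of subspaces written as graphs over a fixed base *)

Section GraphParametrization.
Context {R : realType} {E : lmodType R[i]} {ip : E -> E -> R[i]}.
Hypothesis ipP : is_hilbert ip.
Local Notation N := (rnm ip).

Context {k : E -> E -> R} {B L M : E -> Prop} {P : E -> E} {b : R}.
Hypotheses (kP : real_form k) (k_bound : forall x y, `|k x y| <= 1 * N x * N y).
Hypotheses (BP : lin_subspace B) (LP : lin_subspace L).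
Hypotheses (Plin : linear P) (P_bound : forall x, N (P x) <= b * N x).
Hypotheses (P_L : forall x, B x -> L (P x)) (P_M : forall x, B x -> M (x - P x)).
Hypotheses (k_LM : forall x y, L x -> M y -> k x y = 0).
Hypothesis k_M : forall x, M x -> k x x <= 0.

(** Pythagoras for [k]: the cross terms vanish and the component in [M] contributes a nonpositive
    amount. Hence [P] inherits coercivity on every uniformly positive subspace of [B]. *)
Lemma k_projection x : B x -> k x x <= k (P x) (P x).
Proof.
move=> Bx; have kPQ := k_LM (P_L Bx) (P_M Bx); have kQ := k_M (P_M Bx).
move: kPQ kQ; rewrite !(rformBr kP) !(rformBl kP) (rformC kP x (P x)); lra.
Qed.

Section Single.
Context {W : E -> Prop} {c : R}.
Hypotheses (WP : closed_subspace ip W) (WB : subset_of W B) (c0 : 0 < c).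
Hypothesis k_W : forall w, W w -> c * N w ^+ 2 <= k w w.

(** The difference lies in [W], where [k] is positive, and in [M], where it is nonpositive. *)
Lemma projection_inj w w' : W w -> W w' -> P w = P w' -> w = w'.
Proof.
move=> Ww Ww' Pww'; apply/eqP; rewrite -subr_eq0; apply/eqP.
have Wd := subspaceB WP.1 Ww Ww'; have Md := P_M (WB Wd).
rewrite (linB Plin) Pww' subrr subr0 in Md.
apply: (rnm_eq0 ipP.1); apply/eqP; rewrite -sqrf_eq0; apply/eqP/le_anti.
rewrite sqr_ge0 andbT -(@pmulr_rle0 _ c)//.
exact: le_trans (k_W Wd) (k_M Md).
Qed.

(* The equation [P w = x] is solved in the least squares sense; the error is
   [k]-orthogonal to [W]. *)
Lemma projection_surj : (forall e, L e -> (forall w, W w -> k w e = 0) -> e = 0) ->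
  forall x, L x -> exists2 w, W w & P w = x.
Proof.
move=> dual x Lx.
have [|w Ww hw] := @least_squares R E E ip ip ipP W P k b c 1 WP Plin P_bound kP
  ler01 k_bound c0 _ x.
  by move=> w Ww; apply: le_trans (k_W Ww) (k_projection (WB Ww)).
exists w => //; apply/esym/eqP; rewrite -subr_eq0; apply/eqP.
have Le : L (x - P w) by apply: subspaceB => //; apply/P_L/WB.
(* The error lies in [L], so it cannot see the component of w' in [M]: being orthogonal to P w' is
   being orthogonal to w'. *)
apply: dual => // w' Ww'; rewrite -[w'](subrK (P w')) (rformDl kP) hw// addr0.
by rewrite (rformC kP); apply: k_LM => //; apply/P_M/WB.
Qed.

End Single.

Context {dom : R[i] -> Prop} {W : R[i] -> E -> Prop} {c : R[i] -> R}.
Context {Z : R[i] -> R[i] -> E -> E}.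
Hypothesis W_closed : forall l, dom l -> closed_subspace ip (W l).
Hypothesis WB : forall l, dom l -> subset_of (W l) B.
Hypothesis c_gt0 : forall l, dom l -> 0 < c l.
Hypothesis k_W : forall l, dom l -> forall w, W l w -> c l * N w ^+ 2 <= k w w.
Hypothesis W_dual : forall l, dom l ->
  forall e, L e -> (forall w, W l w -> k w e = 0) -> e = 0.
Hypothesis Zlin : forall l l0, dom l -> dom l0 -> linear (Z l l0).
Hypothesis Z_B : forall l l0, dom l -> dom l0 -> forall w, W l0 w -> B (Z l l0 w).
(** [Z] acts as a divided difference stated without division, so that l = l0 is allowed and
    [Z l0 l0] gives the infinitesimal displacement. *)
Hypothesis Z_W : forall l l0, dom l -> dom l0 -> forall w, W l0 w ->
  W l (w + (l - l0) *: Z l l0 w).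
Hypothesis Z_local : forall l0, dom l0 -> exists del c1 K : R,
  [/\ 0 < del, 0 < c1, 0 <= K &
   forall l, dom l -> cabs (l - l0) < del ->
     [/\ c1 <= c l, (forall w, W l0 w -> N (Z l l0 w) <= K * N w) &
      (forall w, W l0 w ->
         N (Z l l0 w - Z l0 l0 w) <= K * cabs (l - l0) * N w)]].

(* If [G l x] is the point of [W l] above [x], then
   [G l x - G l0 x = (l - l0) *: (z - G l (P z))] with [z := Z l l0 (G l0 x)]. *)
Lemma graph_holomorphic : holomorphic_param ip L M W dom.
Proof.
have innP := ipP.1.
(* Choice is made on pairs, with the default 0 outside [dom] and [L]. *)
have /choice[G0 G0P] : forall lx : R[i] * E, exists w,
    dom lx.1 -> L lx.2 -> W lx.1 w /\ P w = lx.2.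
  move=> [l x] /=; have [dl|ndl] := pselect (dom l); last by exists 0.
  have [Lx|nLx] := pselect (L x); last by exists 0.
  have [w Ww Pw] :=
    projection_surj (W_closed dl) (WB dl) (c_gt0 dl) (k_W dl) (W_dual dl) Lx.
  by exists w.
pose G l x := G0 (l, x).
have GW l x : dom l -> L x -> W l (G l x) by move=> dl Lx; case: (G0P (l, x)).
have PG l x : dom l -> L x -> P (G l x) = x by move=> dl Lx; case: (G0P (l, x)).
have GB l x : dom l -> L x -> B (G l x) by move=> dl Lx; apply: (WB dl); apply: GW.
have inj l w w' : dom l -> W l w -> W l w' -> P w = P w' -> w = w'.
  by move=> dl; exact: (projection_inj (W_closed dl) (WB dl) (c_gt0 dl) (k_W dl)).
have Glin l a x y : dom l -> L x -> L y -> G l (a *: x + y) = a *: G l x + G l y.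
  move=> dl Lx Ly; have Lz : L (a *: x + y) by apply: LP.2.
  apply: (inj l) => //; first exact: GW.
    by apply: (W_closed dl).1.2; apply: GW.
  by rewrite (linD Plin) (linZ Plin) !PG.
have G_bound l c1 x : dom l -> 0 < c1 -> c1 <= c l -> L x ->
    N (G l x) <= (c1^-1 + 1) * N x.
  move=> dl c10 c1l Lx.
  have h1 : c1 * N (G l x) ^+ 2 <= N x ^+ 2.
    apply: le_trans (_ : c l * N (G l x) ^+ 2 <= _); first by rewrite ler_wpM2r ?sqr_ge0.
    apply: le_trans (k_W dl (GW _ _ dl Lx)) _.
    apply: le_trans (k_projection (GB _ _ dl Lx)) _; rewrite PG//.
    by apply: le_trans (ler_norm _) _; apply: le_trans (k_bound _ _) _; rewrite mul1r.
  have i0 : 0 < c1^-1 by rewrite invr_gt0.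
  (* The square of 1 / c1 + 1 dominates 1 / c1, which spares a square root in the constant. *)
  rewrite -(@ler_pXn2r _ 2) ?nnegrE ?mulr_ge0 ?rnm_ge0 ?addr_ge0 ?(ltW i0)//.
  have : c1^-1 * (c1 * N (G l x) ^+ 2) <= c1^-1 * N x ^+ 2 by rewrite ler_pM2l.
  rewrite mulrA mulVf ?gt_eqF// mul1r exprMn => /le_trans; apply.
  by rewrite ler_wpM2r ?sqr_ge0//; nra.
(* Removing the point of [W l] with the same image under [P] leaves a vector of [M]. *)
pose Q l x := x - G l (P x).
have QM l x : dom l -> B x -> M (Q l x).
  move=> dl Bx; have LPx := P_L Bx.
  have /P_M : B (Q l x) by apply: subspaceB => //; apply: GB.
  by rewrite (linB Plin) PG// subrr subr0.
have Q_bound l c1 x : dom l -> 0 < c1 -> c1 <= c l -> B x ->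
    N (Q l x) <= (1 + (c1^-1 + 1) * b) * N x.
  move=> dl c10 c1l Bx; apply: le_trans (rnmB innP _ _) _.
  rewrite mulrDl mul1r lerD2l; apply: le_trans (G_bound _ _ _ dl c10 c1l (P_L Bx)) _.
  by rewrite -mulrA ler_wpM2l// addr_ge0// invr_ge0 ltW.
have Qlin l a x y : dom l -> B x -> B y -> Q l (a *: x + y) = a *: Q l x + Q l y.
  move=> dl Bx By; rewrite /Q Plin Glin//; [|exact: P_L|exact: P_L].
  by rewrite scalerBr opprD addrACA.
have Gdiff l l0 x : dom l -> dom l0 -> L x ->
    G l x - G l0 x = (l - l0) *: Q l (Z l l0 (G l0 x)).
  move=> dl dl0 Lx; have Wl0 := GW _ _ dl0 Lx; have LPZ := P_L (Z_B dl dl0 Wl0).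
  apply/eqP; rewrite subr_eq addrC; apply/eqP.
  have Wsub := (W_closed dl).1.
  (* Both sides are points of [W l] above x, so injectivity of [P] on [W l] identifies them. *)
  rewrite /Q scalerBr addrA; apply: (inj l) => //; first exact: GW.
    apply: subspaceB => //; first exact: Z_W.
    by apply: subspaceZ => //; apply: GW.
  by rewrite (linB Plin) (linD Plin) !(linZ Plin) !PG// addrK.
exists (fun l x => G l x - x); split.
- move=> l dl x Lx; rewrite -[x in _ - x](PG l)//; exact/P_M/GB.
- by move=> l dl a x y Lx Ly; rewrite Glin// scalerBr opprD addrACA.
- move=> l dl; exists ((c l)^-1 + 1 + 1)%:C%C => x Lx.
  rewrite !(hnormE innP) -rmorphM lecR [leRHS]mulrDl mul1r.
  by apply: le_trans (rnmB innP _ _) _; rewrite lerD2r G_bound ?c_gt0.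
- move=> l dl y; split=> [Wy|[x [Lx ->]]].
    have LPy := P_L (WB dl Wy); exists (P y); split=> //.
    rewrite addrC subrK; apply: (inj l) => //; first exact: GW.
    by rewrite PG.
  by rewrite addrC subrK; apply: GW.
(* The candidate derivative is the quotient in [Gdiff] evaluated at l = l0. *)
move=> l0 dl0; exists (fun x => Q l0 (Z l0 l0 (G l0 x))).
have [del [c1 [K [del0 c10 K0 loc]]]] := Z_local dl0.
pose g := c1^-1 + 1; have g0 : 0 < g by rewrite addr_gt0 ?invr_gt0.
pose b1 := `|b|; have b1E x : N (P x) <= b1 * N x.
  by apply: le_trans (P_bound x) _; rewrite ler_wpM2r ?rnm_ge0 ?ler_norm.
have b10 : 0 <= b1 by exact: normr_ge0.
pose q := 1 + g * b1.
have q0 : 0 < q by rewrite ltr_pwDl// mulr_ge0 ?(ltW g0).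
have q_bound l x : dom l -> c1 <= c l -> B x -> N (Q l x) <= q * N x.
  move=> dl c1l Bx; apply: le_trans (Q_bound _ _ _ dl c10 c1l Bx) _.
  by rewrite ler_wpM2r ?rnm_ge0// lerD2l ler_wpM2l ?(ltW g0) ?ler_norm.
have cl0 : c1 <= c l0.
  by have [] := loc l0 dl0; rewrite // subrr /cabs normr0.
have Zl0 w : W l0 w -> N (Z l0 l0 w) <= K * N w.
  by have [] := loc l0 dl0; [rewrite subrr /cabs normr0 | auto].
split.
- by move=> x Lx; apply: QM => //; apply: Z_B => //; apply: GW.
- move=> a x y Lx Ly; rewrite Glin// Zlin// Qlin//; apply: Z_B => //; exact: GW.
- exists (q * (K * g))%:C%C => x Lx; rewrite !(hnormE innP) -rmorphM lecR -!mulrA.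
  have Gx := GW _ _ dl0 Lx.
  apply: le_trans (q_bound _ _ dl0 cl0 (Z_B dl0 dl0 Gx)) _.
  rewrite ler_pM2l//; apply: le_trans (Zl0 _ Gx) _.
  by rewrite ler_wpM2l// G_bound.
move=> _ /pos_real[eps eps0 ->].
(* The term 1 accounts for the variation of [Z] with l, the other one for the variation of [Q]. *)
pose C := q * K * g * (1 + K * g * b1).
have C0 : 0 <= C.
  have [qge gge] := (ltW q0, ltW g0).
  exact: mulr_ge0 (mulr_ge0 (mulr_ge0 qge K0) gge)
    (addr_ge0 ler01 (mulr_ge0 (mulr_ge0 K0 gge) b10)).
have C10 : 0 < C + 1 by rewrite ltr_wpDl.
exists (Num.min del (eps / (C + 1)))%:C%C; split.
  by rewrite ltcR lt_min del0 divr_gt0.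
move=> l dl; rewrite norm_cabs ltcR lt_min => /andP[ldel leps] x Lx.
have [cl Zl ZZ] := loc l dl ldel; set d := cabs (l - l0) in leps ZZ *.
have d0 : 0 <= d := cabs_ge0 _.
rewrite !(hnormE innP) -!rmorphM lecR.
have -> : G l x - x - (G l0 x - x) = G l x - G l0 x by rewrite opprB addrA subrK.
rewrite Gdiff// -scalerBr (rnmZ innP) -/d [eps * d]mulrC -mulrA.
apply: ler_wpM2l => //.
have Ww := GW _ _ dl0 Lx; set w := G l0 x in Ww *.
have Nw : N w <= g * N x by rewrite G_bound.
have BZ := Z_B dl dl0 Ww; have BZ0 := Z_B dl0 dl0 Ww.
(* The change of [Q] at a fixed vector is minus a change of [G], so [Gdiff] applies a second time
   and yields another factor l - l0. *)
have -> : Q l (Z l l0 w) - Q l0 (Z l0 l0 w) =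
    Q l (Z l l0 w - Z l0 l0 w) - (l - l0) *: Q l (Z l l0 (G l0 (P (Z l0 l0 w)))).
  have -> : Q l (Z l l0 w - Z l0 l0 w) = Q l (Z l l0 w) - Q l (Z l0 l0 w).
    by rewrite [in LHS]addrC -scaleN1r Qlin// scaleN1r addrC.
  rewrite -Gdiff//; last exact: P_L.
  rewrite /Q !opprB -[RHS]addrA; congr (_ + _).
  by rewrite [RHS]addrC addrA subrK.
apply: le_trans (rnmB innP _ _) _; rewrite (rnmZ innP) -/d.
have LP0 := P_L BZ0; have Ww' := GW _ _ dl0 LP0.
have h1 : N (Q l (Z l l0 w - Z l0 l0 w)) <= q * (K * d * (g * N x)).
  apply: le_trans (q_bound _ _ dl cl (subspaceB BP BZ BZ0)) _.
  rewrite ler_pM2l//; apply: le_trans (ZZ _ Ww) _.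
  by rewrite ler_wpM2l ?mulr_ge0.
have h2 : N (Q l (Z l l0 (G l0 (P (Z l0 l0 w))))) <=
    q * (K * (g * (b1 * (K * (g * N x))))).
  apply: le_trans (q_bound _ _ dl cl (Z_B dl dl0 Ww')) _.
  rewrite ler_pM2l//; apply: le_trans (Zl _ Ww') _; rewrite ler_wpM2l//.
  apply: le_trans (G_bound _ _ _ dl0 c10 cl0 LP0) _; rewrite ler_pM2l//.
  apply: le_trans (b1E _) _; rewrite ler_wpM2l//.
  by apply: le_trans (Zl0 _ Ww) _; rewrite ler_wpM2l.
apply: le_trans (_ : d * C * N x <= _).
  have -> : d * C * N x = q * (K * d * (g * N x)) +
     d * (q * (K * (g * (b1 * (K * (g * N x)))))) by rewrite /C; ring.
  by rewrite lerD// ler_wpM2l.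
rewrite ler_wpM2r ?rnm_ge0//.
move: leps; rewrite ltr_pdivlMr// => /ltW/(le_trans _); apply.
by rewrite ler_wpM2l// lerDl.
Qed.

End GraphParametrization.

(** * Partial isometries and the graph of the transfer function *)

Section TransferFunction.
Context {R : realType} {H : lmodType R[i]} {ip : H -> H -> R[i]}.
Hypothesis ipP : is_hilbert ip.
Local Notation r := (rip ip).
Local Notation N := (rnm ip).

Lemma open_discE (l : R[i]) : open_disc l <-> cabs l < 1.
Proof. by rewrite /open_disc norm_cabs -ltcR. Qed.

(* [S] is the adjoint of the partial isometry [V]. *)
Definition partial_isometry (ip : H -> H -> R[i]) (V S : H -> H) :=
  [/\ linear V, linear S, (forall x y, rip ip (V x) y = rip ip x (S y)),
      (forall x, V (S (V x)) = V x) & (forall x, S (V (S x)) = S x)].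

Lemma partial_isometryC V S : partial_isometry ip V S -> partial_isometry ip S V.
Proof.
by case=> [V1 S1 adj VSV SVS]; split=> // x y; rewrite (ripC ipP.1) -adj (ripC ipP.1).
Qed.

(** The squared norm of x - S V x equals |x|^2 - |V x|^2. *)
Lemma partial_isometry_contraction V S : partial_isometry ip V S ->
  forall x, N (V x) <= N x.
Proof.
case=> [V1 S1 adj VSV SVS] x.
have h : r (V x) (V x) = r (S (V x)) (S (V x)).
  by rewrite -[in RHS]adj VSV.
have h0 : r x (S (V x)) = r (V x) (V x) by rewrite -adj.
have := rip_ge0 ipP.1 (x - S (V x)).
rewrite !(ripBl ipP.1, ripBr ipP.1) (ripC ipP.1 (S _) x) -h h0 -!(rnm_sqr ipP.1).
rewrite subrr subr0 subr_ge0.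
by rewrite ler_pXn2r ?nnegrE ?rnm_ge0.
Qed.

(* The graph of the transfer function [l *: (1 - V S) (1 - l S)^-1] from [ker V]
   to [ker S]. *)
Definition transfer_graph (V S : H -> H) (l : R[i]) (u v : H) :=
  V u = 0 /\ exists x, u = x - l *: S x /\ v = l *: (x - V (S x)).

Context {V S : H -> H}.
Hypothesis VS : partial_isometry ip V S.
Let Vlin : linear V. Proof. by case: VS. Qed.
Let Slin : linear S. Proof. by case: VS. Qed.
Let adj x y : r (V x) y = r x (S y). Proof. by case: VS. Qed.
Let adj' x y : r (S x) y = r x (V y).
Proof. by rewrite (ripC ipP.1) -adj (ripC ipP.1). Qed.
Let VSV x : V (S (V x)) = V x. Proof. by case: VS. Qed.
Let SVS x : S (V (S x)) = S x. Proof. by case: VS. Qed.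
Let S_le x : N (S x) <= N x.
Proof. exact: (partial_isometry_contraction (partial_isometryC VS)). Qed.

Lemma transfer_graph_lin l a u v u' v' :
  transfer_graph V S l u v -> transfer_graph V S l u' v' ->
  transfer_graph V S l (a *: u + u') (a *: v + v').
Proof.
move=> [Vu [x [ux vx]]] [Vu' [x' [ux' vx']]]; split.
  by rewrite Vlin Vu Vu' scaler0 addr0.
exists (a *: x + x'); rewrite !Slin Vlin ux vx ux' vx'; split.
  by rewrite scalerBr !scalerDr opprD !scalerA [l * a]mulrC addrACA.
rewrite scalerA [a * l]mulrC -scalerA -scalerDr; congr (_ *: _).
by rewrite scalerBr opprD addrACA.
Qed.

Lemma transfer_graph_ker l u v : transfer_graph V S l u v -> V u = 0 /\ S v = 0.
Proof.
move=> [Vu [x [_ ->]]]; split=> //.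
by rewrite (linZ Slin) (linB Slin) SVS subrr scaler0.
Qed.

(** The constant combines |u|^2 + |v|^2 <= 2 |x|^2 with 1 - |l|^2 >= 1 - |l|. *)
Lemma transfer_graph_energy l u v : cabs l < 1 -> transfer_graph V S l u v ->
  (1 - cabs l) / 2 * (N u ^+ 2 + N v ^+ 2) <= N u ^+ 2 - N v ^+ 2.
Proof.
move=> l1 [Vu [x [ux vx]]].
(* This is S applied to V u = 0. It makes u the component x - S V x of x in ker V and gives |V x| =
   |l| |S x|. *)
have lS : l *: S x = S (V x).
  have : S (V u) = 0 by rewrite Vu (lin0 Slin).
  rewrite ux (linB Vlin) (linB Slin) (linZ Vlin) (linZ Slin) SVS => /eqP.
  by rewrite subr_eq0 => /eqP.
have nSV : N (S (V x)) ^+ 2 = N (V x) ^+ 2.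
  by rewrite !(rnm_sqr ipP.1) -adj VSV.
have nVS : N (V (S x)) ^+ 2 = N (S x) ^+ 2.
  by rewrite !(rnm_sqr ipP.1) adj SVS.
have nV : N (V x) ^+ 2 = cabs l ^+ 2 * N (S x) ^+ 2.
  by rewrite -nSV -lS (rnmZ ipP.1) exprMn.
have nu : N u ^+ 2 = N x ^+ 2 - N (V x) ^+ 2.
  rewrite ux lS [LHS](rnm_sqr ipP.1) !(ripBl ipP.1, ripBr ipP.1).
  rewrite (ripC ipP.1 x (S _)) adj' -!(rnm_sqr ipP.1) nSV; ring.
have nv : N v ^+ 2 = cabs l ^+ 2 * (N x ^+ 2 - N (S x) ^+ 2).
  rewrite vx (rnmZ ipP.1) exprMn; congr (_ * _).
  rewrite [LHS](rnm_sqr ipP.1) !(ripBl ipP.1, ripBr ipP.1).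
  rewrite (ripC ipP.1 x (V _)) adj -!(rnm_sqr ipP.1) nVS; ring.
have l0 := cabs_ge0 l; have x0 := sqr_ge0 (N x); have Sx0 := sqr_ge0 (N (S x)).
have Vx0 := sqr_ge0 (N (V x)).
have -> : N u ^+ 2 - N v ^+ 2 = (1 - cabs l ^+ 2) * N x ^+ 2.
  by rewrite nu nv nV; ring.
have h : N u ^+ 2 + N v ^+ 2 <= 2 * N x ^+ 2.
  have l2 : cabs l ^+ 2 <= 1 by rewrite expr_le1// ltW.
  have := mulr_ge0 (sqr_ge0 (cabs l)) Sx0; have := ler_wpM2r x0 l2.
  by rewrite nu nv; lra.
apply: le_trans (_ : (1 - cabs l) / 2 * (2 * N x ^+ 2) <= _).
  by rewrite ler_wpM2l// divr_ge0// subr_ge0 ltW.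
have -> : (1 - cabs l) / 2 * (2 * N x ^+ 2) = (1 - cabs l) * N x ^+ 2 by field.
by rewrite ler_wpM2r//; nra.
Qed.

Section Resolvent.
Context {l : R[i]}.
Hypothesis l1 : cabs l < 1.

Lemma resolvent_lin : linear (fun x => x - l *: S x).
Proof.
by move=> a x z; rewrite Slin scalerDr scalerBr opprD addrACA !scalerA [l * a]mulrC.
Qed.

Lemma resolvent_lower x : (1 - cabs l) * N x <= N (x - l *: S x).
Proof.
have h : N x <= N (x - l *: S x) + cabs l * N (S x).
  by rewrite -(rnmZ ipP.1) -[X in N X <= _](subrK (l *: S x)) rnmD//; exact: ipP.1.
by have := ler_wpM2l (cabs_ge0 l) (S_le x); lra.
Qed.

Lemma resolvent_inj x y : x - l *: S x = y - l *: S y -> x = y.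
Proof.
move=> h; apply/eqP; rewrite -subr_eq0; apply/eqP/(rnm_eq0 ipP.1)/le_anti.
rewrite rnm_ge0 andbT -(@pmulr_rle0 _ (1 - cabs l)) ?subr_gt0//.
apply: le_trans (resolvent_lower _) _.
have /= -> := linB resolvent_lin x y; rewrite h subrr.
by rewrite (rnm0 ipP.1).
Qed.

Lemma resolvent_surj y : exists x, x - l *: S x = y.
Proof.
have flin := resolvent_lin; set f := (fun x => x - l *: S x) in flin.
have [||||||p _ hp] := @least_squares R H H ip ip ipP (@whole H) f r
  (1 + cabs l) ((1 - cabs l) ^+ 2) 1 _ flin _ _ ler01 _ _ _ y.
- by [].
- move=> x; apply: le_trans (rnmB ipP.1 _ _) _; rewrite mulrDl mul1r lerD2l.
  by rewrite (rnmZ ipP.1) ler_wpM2l ?cabs_ge0.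
- split=> [x z|z]; first exact: (ripC ipP.1).
  by split=> [x x'|a x]; rewrite ?(ripDl ipP.1) ?(ripZ ipP.1).
- by move=> x z; rewrite mul1r (cauchy_schwarz_norm ipP.1).
- by rewrite exprn_gt0// subr_gt0.
- move=> x _; rewrite -exprMn -(rnm_sqr ipP.1) ler_pXn2r ?nnegrE ?mulr_ge0 ?rnm_ge0//.
    exact: resolvent_lower.
  by rewrite subr_ge0 ltW.
exists p; apply/esym/eqP; rewrite -subr_eq0; apply/eqP; set e := y - _ in hp *.
(* The residual e is orthogonal to the range. Testing with the image of e itself gives (1 - |l|)
   |e|^2 <= 0. *)
apply: (rnm_eq0 ipP.1); have := hp e I; rewrite /f (ripBl ipP.1) -(rnm_sqr ipP.1).
have h := cauchy_schwarz ipP.1 (l *: S e) e; rewrite (rnmZ ipP.1) in h.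
have h2 : cabs l * N (S e) * N e <= cabs l * N e * N e.
  by rewrite ler_wpM2r ?rnm_ge0// ler_wpM2l ?cabs_ge0.
move=> h3; apply/eqP; rewrite -sqrf_eq0; apply/eqP/le_anti; rewrite sqr_ge0 andbT.
by rewrite -(@pmulr_rle0 _ (1 - cabs l)) ?subr_gt0//; lra.
Qed.

End Resolvent.

Lemma transfer_graph_surj l u : cabs l < 1 -> V u = 0 ->
  exists v, transfer_graph V S l u v.
Proof.
move=> l1 Vu; have [x hx] := resolvent_surj l1 u.
by exists (l *: (x - V (S x))); split=> //; exists x.
Qed.

(** The conditions V u = 0 and S v' = 0 remove the terms in S V and V S; both sides then equal the
    real part of l (x - l S x, y). *)
Lemma transfer_graph_orth l u v u' v' :
  transfer_graph V S l u v -> transfer_graph S V l^* v' u' -> r u u' = r v v'.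
Proof.
move=> [Vu [x [ux vx]]] [Sv' [y [vy uy]]].
have -> : r u u' = r (l *: u) y.
  by rewrite uy -(rip_adj ipP.1) (ripBr ipP.1) -adj (linZ Vlin) Vu
    scaler0 (rip0l ipP.1) subr0.
have -> : r v v' = r (l *: x) v'.
  by rewrite vx scalerBr (ripBl ipP.1) -(linZ Vlin) adj Sv' (rip0r ipP.1) subr0.
rewrite ux vy scalerBr (ripBl ipP.1) (ripBr ipP.1); congr (_ - _).
by rewrite -(rip_adj ipP.1) -adj' !(linZ Slin).
Qed.

Lemma resolvent_exists : exists Q : R[i] -> H -> H, forall l, cabs l < 1 ->
  [/\ linear (Q l), (forall y, Q l y - l *: S (Q l y) = y),
      (forall x, Q l (x - l *: S x) = x) &
      (forall y, (1 - cabs l) * N (Q l y) <= N y)].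
Proof.
have /choice[Q QP] : forall ly : R[i] * H, exists x, cabs ly.1 < 1 ->
    x - ly.1 *: S x = ly.2.
  move=> [l y] /=; have [l1|_] := boolP (cabs l < 1); last by exists 0.
  by have [x] := resolvent_surj l1 y; exists x.
exists (fun l y => Q (l, y)) => l l1.
have QE y : Q (l, y) - l *: S (Q (l, y)) = y by exact: (QP (l, y)).
split=> //.
- move=> a x y; apply: (resolvent_inj l1); rewrite QE.
  by have := @resolvent_lin l a (Q (l, x)) (Q (l, y)); rewrite /= !QE.
- by move=> x; apply: (resolvent_inj l1); rewrite QE.
- by move=> y; rewrite -[X in _ <= N X]QE; apply: resolvent_lower.
Qed.

(* [Z l l0 = (1 - V S) (1 - l S)^-1 (1 - l0 S)^-1] is the divided difference of the
   transfer function. *)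
Lemma transfer_difference : exists Z : R[i] -> R[i] -> H -> H,
  [/\ (forall l l0, cabs l < 1 -> cabs l0 < 1 -> linear (Z l l0)),
      (forall l l0 u, S (Z l l0 u) = 0),
      (forall l l0 u v, cabs l < 1 -> cabs l0 < 1 -> transfer_graph V S l0 u v ->
        transfer_graph V S l u (v + (l - l0) *: Z l l0 u)) &
      (forall rho : R, 0 <= rho -> rho < 1 -> exists2 K, 0 <= K &
        forall l l0, cabs l <= rho -> cabs l0 <= rho -> forall u,
          N (Z l l0 u) <= K * N u /\
          N (Z l l0 u - Z l0 l0 u) <= K * cabs (l - l0) * N u)].
Proof.
have [Q QP] := resolvent_exists.
pose D x := x - V (S x).
have Dlin : linear D.
  by move=> a x y; rewrite /D Slin Vlin scalerBr opprD addrACA.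
exists (fun l l0 u => D (Q l (Q l0 u))); split.
- move=> l l0 l1 l01 a x y; have [Ql _ _ _] := QP l l1; have [Q0 _ _ _] := QP l0 l01.
  by rewrite Q0 Ql Dlin.
- by move=> l l0 u; rewrite /D (linB Slin) SVS subrr.
- move=> l l0 u v l1 l01 [Vu [x [ux ->]]].
  have [Ql QE QK _] := QP l l1; have [_ _ Q0K _] := QP l0 l01.
  split=> //; exists (Q l u); rewrite QE; split=> //.
  rewrite {1}ux Q0K -/(D x) -/(D (Q l u)) -!(linZ Dlin) -(linD Dlin); congr (D _).
  (* What remains is l0 x + (l - l0) Q_l x = l Q_l u for u = (1 - l0 S) x, checked after applying 1
     - l S. *)
  apply: (@resolvent_inj l l1); have rl := @resolvent_lin l.
  have /= -> := linD rl (l0 *: x) ((l - l0) *: Q l x).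
  have /= -> := linZ rl l0 x; have /= -> := linZ rl (l - l0) (Q l x).
  have /= -> := linZ rl l (Q l u); rewrite !QE ux.
  rewrite scalerBl !scalerBr !scalerA [l0 * l]mulrC.
  by rewrite [LHS]addrC addrA subrK.
move=> rho rho0 rho1; pose g := (1 - rho)^-1.
have g0 : 0 < g by rewrite invr_gt0 subr_gt0.
have Qb l y : cabs l <= rho -> N (Q l y) <= g * N y.
  move=> lr; have l1 := le_lt_trans lr rho1; have [_ _ _ h] := QP l l1.
  rewrite -ler_pdivrMl ?invrK; last by rewrite invr_gt0 subr_gt0.
  by apply: le_trans (h y); rewrite ler_wpM2r ?rnm_ge0 ?lerD2l ?lerN2.
have Db x : N (D x) <= 2 * N x.
  apply: le_trans (rnmB ipP.1 _ _) _; rewrite mulr_natl mulr2n lerD2l.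
  exact: le_trans (partial_isometry_contraction VS _) (S_le x).
have gge := ltW g0.
(* The factor 2 bounds 1 - V S, and each resolvent costs g: two of them occur in [Z], three in its
   increment. *)
exists (2 * g ^+ 2 + 2 * g ^+ 3) => [|l l0 lr l0r u].
  by rewrite addr_ge0// mulr_ge0// exprn_ge0.
have l1 := le_lt_trans lr rho1; have l01 := le_lt_trans l0r rho1.
have u0 := rnm_ge0 (ip := ip) u; split.
  apply: le_trans (Db _) _.
  apply: le_trans (_ : 2 * (g * (g * N u)) <= _).
    by rewrite ler_pM2l//; apply: le_trans (Qb _ _ lr) _; rewrite ler_pM2l// Qb.
  have -> : 2 * (g * (g * N u)) = 2 * g ^+ 2 * N u by ring.
  by rewrite ler_wpM2r// lerDl mulr_ge0// exprn_ge0.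
have [Ql QE QK _] := QP l l1; have [_ Q0E _ _] := QP l0 l01.
(* Resolvent identity: Q_l - Q_l0 = (l - l0) Q_l S Q_l0. *)
have -> : D (Q l (Q l0 u)) - D (Q l0 (Q l0 u)) =
    (l - l0) *: D (Q l (S (Q l0 (Q l0 u)))).
  set y := Q l0 u; rewrite -(linB Dlin) -(linZ Dlin); congr (D _).
  apply: (@resolvent_inj l l1); have rl := @resolvent_lin l.
  have /= -> := linB rl (Q l y) (Q l0 y).
  have /= -> := linZ rl (l - l0) (Q l (S (Q l0 y))).
  rewrite !QE -{1}[y](Q0E) opprB addrACA addrA; rewrite scalerBl.
  by rewrite -[_ + _ - _ *: _]addrA [Q l0 y + _]addrC addrK.
rewrite (rnmZ ipP.1).
apply: le_trans (_ : cabs (l - l0) * (2 * (g * (g * (g * N u)))) <= _).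
  rewrite ler_wpM2l ?cabs_ge0//; apply: le_trans (Db _) _; rewrite ler_pM2l//.
  apply: le_trans (Qb _ _ lr) _; rewrite ler_pM2l//; apply: le_trans (S_le _) _.
  by apply: le_trans (Qb _ _ l0r) _; rewrite ler_pM2l// Qb.
have -> : cabs (l - l0) * (2 * (g * (g * (g * N u)))) =
  2 * g ^+ 3 * cabs (l - l0) * N u by ring.
by rewrite ler_wpM2r// ler_wpM2r ?cabs_ge0// lerDr mulr_ge0// exprn_ge0.
Qed.

End TransferFunction.

(** Let p' be the value over q in the swapped graph. Since p - p' is in ker V, it has some v over
    it, and (p - p', p) and (p - p', p') both equal (v, q) in real part. *)
Lemma transfer_graph_dual (R : realType) (H : lmodType R[i]) (ip : H -> H -> R[i])
    (V S : H -> H) (l : R[i]) (p q : H) :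
  is_hilbert ip -> partial_isometry ip V S -> cabs l < 1 -> V p = 0 -> S q = 0 ->
  (forall u v, transfer_graph V S l u v -> rip ip u p = rip ip v q) ->
  transfer_graph S V l^* q p.
Proof.
move=> ipP VS l1 Vp Sq h; have SV := partial_isometryC ipP VS.
have [|p' hp'] := transfer_graph_surj ipP SV (l := l^*) _ Sq; first by rewrite cabsJ.
suff -> : p = p' by [].
have [_ Vp'] := transfer_graph_ker SV hp'; have [Vlin _ _ _ _] := VS.
have [|v hv] := transfer_graph_surj ipP VS (u := p - p') l1.
  by rewrite (linB Vlin) Vp Vp' subrr.
apply/eqP; rewrite -subr_eq0; apply/eqP/(rip_eq0 ipP.1).
rewrite [LHS](ripBr ipP.1) (h _ _ hv) (transfer_graph_orth ipP VS hv hp').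
by rewrite subrr.
Qed.

(** * Projections along the complement for a form *)

Section FormProjection.
Context {R : realType} {E : lmodType R[i]} {ip : E -> E -> R[i]}.
Hypothesis ipP : is_hilbert ip.
Local Notation N := (rnm ip).

(** This takes the place of continuity in the closedness proofs: a fixed number is dominated by the
    distance to the limit. *)
Lemma limit_bound (u : nat -> E) l (t M : R) : seq_converges ip u l -> 0 <= M ->
  (forall n, t <= M * N (u n - l)) -> t <= 0.
Proof.
move=> /(seq_convergesE ipP.1) ul M0 h; rewrite leNgt; apply/negP => t0.
have M1 : 0 < M + 1 by rewrite ltr_wpDl.
have [n0 hn0] := ul (t / (M + 1)) (divr_gt0 t0 M1).
have := hn0 n0 (leqnn _); rewrite ltr_pdivlMr// => h1.
have h2 := h n0; have := rnm_ge0 (ip := ip) (u n0 - l); move: h1 h2.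
by move: (N _) => x; nra.
Qed.

Lemma rip_inj x y : (forall z, rip ip z x = rip ip z y) -> x = y.
Proof.
move=> h; apply/eqP; rewrite -subr_eq0; apply/eqP/(rip_eq0 ipP.1).
by rewrite [LHS](ripBr ipP.1) h subrr.
Qed.

(** Used for the orthogonal projection onto K and for the projection onto L0 along its symplectic
    complement. The compatibility of [k] with complex scalars makes [P] complex linear; the norm
    bound follows from k (P x) (P x) = k (P x) x. *)
Lemma form_projection (L : E -> Prop) (k : E -> E -> R) (c : R) :
  closed_subspace ip L -> real_form k ->
  (forall a x y, k (a *: x) y = k x (a^* *: y)) ->
  (forall x y, `|k x y| <= 1 * N x * N y) ->
  0 < c -> (forall x, L x -> c * N x ^+ 2 <= k x x) ->
  exists P : E -> E,
    [/\ linear P, (forall x, L (P x)), (forall x y, L x -> k x (y - P y) = 0),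
        (forall x p, L p -> (forall y, L y -> k y (x - p) = 0) -> P x = p) &
        (forall x, N (P x) <= c^-1 * N x)].
Proof.
move=> LP kP kadj kb c0 kc.
have /choice[P PP] : forall y, exists p, L p /\ forall x, L x -> k x (y - p) = 0.
  move=> y; have [||p Lp hp] :=
    @least_squares R E E ip ip ipP L id k 1 c 1 LP _ _ kP ler01 kb c0 kc y => //.
  - by move=> x; rewrite mul1r.
  - by exists p.
have PL x : L (P x) by case: (PP x).
have P0 x y : L x -> k x (y - P y) = 0 by move=> Lx; case: (PP y) => _; apply.
have uniq x p : L p -> (forall y, L y -> k y (x - p) = 0) -> P x = p.
  move=> Lp hp; apply/eqP; rewrite -subr_eq0; apply/eqP.
  have Ld := subspaceB LP.1 (PL x) Lp; apply: (rnm_eq0 ipP.1).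
  apply/eqP; rewrite -sqrf_eq0; apply/eqP/le_anti; rewrite sqr_ge0 andbT.
  rewrite -(@pmulr_rle0 _ c)//; apply: le_trans (kc _ Ld) _.
  have h1 := P0 _ x Ld; have h2 := hp _ Ld; move: h1 h2.
  by rewrite !(rformBr kP); lra.
exists P; split=> //.
- move=> a x y; apply: uniq; first by apply: LP.1.2.
  move=> z Lz; rewrite opprD addrACA -scalerBr (rformDr kP) P0// addr0.
  by rewrite -[a]conjCK -kadj P0//; apply: subspaceZ LP.1 _ _ Lz.
- move=> x; have [->|/eqP Px0] := eqVneq (P x) 0.
    by rewrite (rnm0 ipP.1) mulr_ge0 ?rnm_ge0 ?invr_ge0// ltW.
  rewrite ler_pdivlMl// -(ler_pM2r (rnm_gt0 ipP.1 Px0)).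
  rewrite -mulrA -expr2; apply: le_trans (kc _ (PL x)) _.
  have /eqP := P0 _ x (PL x); rewrite (rformBr kP) subr_eq0 => /eqP <-.
  apply: le_trans (ler_norm _) _; apply: le_trans (kb _ _) _.
  by rewrite mul1r mulrC.
Qed.

End FormProjection.

(** * The model space and its two families of definite subspaces *)

Section Model.
Context {R : realType} {H : lmodType R[i]} {ip : H -> H -> R[i]}.
Hypothesis ipP : is_hilbert ip.
Local Notation HH := (H * H)%type.
Local Notation N := (rnm (ip2 ip)).
Local Notation k := (kform ip).
Let ip2P : is_hilbert (ip2 ip) := ip2_hilbert ipP.
Let kP : real_form k := kform_real_form ipP.

Lemma kform_adj a (x y : HH) : k (a *: x) y = k x (a^* *: y).
Proof. by rewrite /kform /= !(rip_adj ipP.1). Qed.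

Lemma kform_scale a (x : HH) : k (a *: x) (a *: x) = cabs a ^+ 2 * k x x.
Proof. by rewrite /kform /= !(rip_scale ipP.1) mulrBr. Qed.

Context {V S : H -> H}.
Hypothesis VS : partial_isometry ip V S.
Let SV : partial_isometry ip S V := partial_isometryC ipP VS.
Let Vlin : linear V. Proof. by case: VS. Qed.
Let Slin : linear S. Proof. by case: VS. Qed.

Definition Bmodel (a : HH) := V a.1 = 0 /\ S a.2 = 0.
Definition Wpos (l : R[i]) (a : HH) := transfer_graph V S l a.1 a.2.
Definition Wneg (l : R[i]) (a : HH) := transfer_graph S V l a.2 a.1.

Lemma Bmodel_subspace : lin_subspace Bmodel.
Proof.
split; first by rewrite /Bmodel (lin0 Vlin) (lin0 Slin).
move=> a x y [Vx Sx] [Vy Sy]; split; rewrite /= ?Vlin ?Slin.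
  by rewrite Vx Vy scaler0 addr0.
by rewrite Sx Sy scaler0 addr0.
Qed.

Lemma transfer_graph0 V' S' l : partial_isometry ip V' S' -> transfer_graph V' S' l 0 0.
Proof.
case=> [V1 S1 _ _ _]; split; first exact: lin0.
by exists 0; rewrite !(lin0 S1) (lin0 V1) !scaler0 !subr0 scaler0.
Qed.

Lemma Wpos_subspace l : lin_subspace (Wpos l).
Proof.
split; first exact: transfer_graph0.
by move=> a x y; apply: (transfer_graph_lin VS).
Qed.

Lemma Wneg_subspace l : lin_subspace (Wneg l).
Proof.
split; first exact: transfer_graph0.
by move=> a x y; apply: (transfer_graph_lin SV).
Qed.

Lemma Wpos_B l : subset_of (Wpos l) Bmodel.
Proof. by move=> a /(transfer_graph_ker VS)[]. Qed.

Lemma Wneg_B l : subset_of (Wneg l) Bmodel.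
Proof. by move=> a /(transfer_graph_ker SV)[]. Qed.

Lemma Wpos_energy l : cabs l < 1 -> forall a, Wpos l a ->
  (1 - cabs l) / 2 * N a ^+ 2 <= k a a.
Proof.
by move=> l1 a /(transfer_graph_energy ipP VS l1); rewrite -(rnm2_sqr ipP) -(kformE ipP).
Qed.

Lemma Wneg_energy l : cabs l < 1 -> forall a, Wneg l a ->
  (1 - cabs l) / 2 * N a ^+ 2 <= - k a a.
Proof.
move=> l1 a /(transfer_graph_energy ipP SV l1).
by rewrite [_ ^+ 2 + _]addrC -(rnm2_sqr ipP) (kformE ipP) opprB.
Qed.

Lemma Wpos_Wneg_orth l a b : Wpos l a -> Wneg l^* b -> k a b = 0.
Proof. by move=> ha hb; rewrite /kform (transfer_graph_orth ipP VS ha hb) subrr. Qed.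

Lemma Wneg_dual l a : cabs l < 1 -> Bmodel a -> (forall b, Wpos l b -> k b a = 0) ->
  Wneg l^* a.
Proof.
move=> l1 [Va Sa] h; apply: (transfer_graph_dual ipP VS) => // u v uv.
by apply/eqP; rewrite -subr_eq0; apply/eqP/(h (u, v)).
Qed.

Lemma Wpos_dual l a : cabs l < 1 -> Bmodel a -> (forall b, Wneg l b -> k b a = 0) ->
  Wpos l^* a.
Proof.
move=> l1 [Va Sa] h; apply: (transfer_graph_dual ipP SV) => // v u uv.
by apply/esym/eqP; rewrite -subr_eq0; apply/eqP/(h (u, v)).
Qed.

Lemma Bmodel_closed : closed_subspace (ip2 ip) Bmodel.
Proof.
have null x : rnm ip x <= 0 -> x = 0.
  by move=> h; apply: (rnm_eq0 ipP.1); apply/le_anti; rewrite h rnm_ge0.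
split; first exact: Bmodel_subspace.
move=> u l Bu ul; split.
  apply: null; apply: (limit_bound ip2P ul ler01) => n.
  have [Vu _] := Bu n; rewrite mul1r -[V l.1]subr0 -Vu (rnmB_sym ipP.1) -(linB Vlin).
  apply: le_trans (partial_isometry_contraction ipP VS _) _.
  exact: (rnm_fst ipP (u n - l)).
apply: null; apply: (limit_bound ip2P ul ler01) => n.
have [_ Su] := Bu n; rewrite mul1r -[S l.2]subr0 -Su (rnmB_sym ipP.1) -(linB Slin).
apply: le_trans (partial_isometry_contraction ipP SV _) _.
exact: (rnm_snd ipP (u n - l)).
Qed.

Lemma kform_orth_limit (F : HH -> Prop) (u : nat -> HH) l :
  (forall n b, F b -> k b (u n) = 0) -> seq_converges (ip2 ip) u l ->
  forall b, F b -> k b l = 0.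
Proof.
move=> h ul b Fb; apply/eqP; rewrite -normr_eq0; apply/eqP/le_anti.
rewrite normr_ge0 andbT; apply: (limit_bound ip2P ul (rnm_ge0 (ip := ip2 ip) b)) => n.
have -> : k b l = k b (l - u n) by rewrite (rformBr kP) h// subr0.
by rewrite (rnmB_sym ip2P.1); have := kform_bound ipP b (l - u n); rewrite mul1r.
Qed.

(** Duality exhibits it as the form complement in [Bmodel] of the negative subspace at the conjugate
    point, and complements are closed. *)
Lemma Wpos_closed l : cabs l < 1 -> closed_subspace (ip2 ip) (Wpos l).
Proof.
move=> l1; split; first exact: Wpos_subspace.
move=> u a Wu ua; rewrite -[l]conjCK; apply: Wpos_dual; first by rewrite cabsJ.
  by apply: Bmodel_closed.2 ua => n; apply: Wpos_B (Wu n).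
apply: kform_orth_limit ua => n b Wb.
by rewrite (rformC kP) (Wpos_Wneg_orth (Wu n)).
Qed.

Lemma Wneg_closed l : cabs l < 1 -> closed_subspace (ip2 ip) (Wneg l).
Proof.
move=> l1; split; first exact: Wneg_subspace.
move=> u a Wu ua; rewrite -[l]conjCK; apply: Wneg_dual; first by rewrite cabsJ.
  by apply: Bmodel_closed.2 ua => n; apply: Wneg_B (Wu n).
apply: kform_orth_limit ua => n b Wb; apply: (Wpos_Wneg_orth Wb).
by rewrite conjCK.
Qed.

Lemma sform_selfN (a : HH) : 'i * sform ip a a = (- k a a)%:C%C.
Proof. by rewrite rmorphN /= -(sform_self ipP) mulNr opprK. Qed.

Lemma energy_gt0 (c q : R) (a : HH) : 0 < c -> c * N a ^+ 2 <= q -> a <> 0 -> 0 < q.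
Proof.
by move=> c0 h a0; apply: lt_le_trans h; rewrite mulr_gt0// exprn_gt0// (rnm_gt0 ip2P.1).
Qed.

Lemma Wpos_W_plus l : cabs l < 1 -> W_plus (ip2 ip) (sform ip) Bmodel (Wpos l).
Proof.
move=> l1; have c0 : 0 < (1 - cabs l) / 2 by rewrite divr_gt0// subr_gt0.
split.
- exact: Wpos_closed.
- exact: Wpos_B.
- move=> x Wx x0; rewrite (sform_self ipP) ltcR.
  exact: energy_gt0 c0 (Wpos_energy l1 Wx) x0.
- move=> L' L'P L'B WL' L'pos x L'x; have [Vx _] := L'B _ L'x.
  (* Subtracting the graph point with the same first component leaves a vector on which the form is
     nonpositive, hence 0. *)
  have [v Wv] := transfer_graph_surj ipP VS l1 Vx.
  have L'd := subspaceB L'P L'x (WL' (x.1, v) Wv).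
  have [d0|/eqP d0] := eqVneq (x - (x.1, v)) 0.
    by move/eqP: d0; rewrite subr_eq0 => /eqP ->.
  have := L'pos _ L'd d0; rewrite (sform_self ipP) ltcR (kformE ipP) /= subrr.
  by rewrite (rnm0 ipP.1) expr0n sub0r oppr_gt0 ltNge sqr_ge0.
- exists ((1 - cabs l) / 2)%:C%C; split; first by rewrite ltcR.
  move=> x Wx; rewrite (hnormE ip2P.1) (sform_self ipP) -rmorphXn -rmorphM lecR.
  exact: Wpos_energy.
Qed.

Lemma Wneg_W_minus l : cabs l < 1 -> W_minus (ip2 ip) (sform ip) Bmodel (Wneg l).
Proof.
move=> l1; have c0 : 0 < (1 - cabs l) / 2 by rewrite divr_gt0// subr_gt0.
split.
- exact: Wneg_closed.
- exact: Wneg_B.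
- move=> x Wx x0; rewrite sform_selfN ltcR.
  exact: energy_gt0 c0 (Wneg_energy l1 Wx) x0.
- move=> L' L'P L'B WL' L'neg x L'x; have [_ Sx] := L'B _ L'x.
  have [v Wv] := transfer_graph_surj ipP SV l1 Sx.
  have L'd := subspaceB L'P L'x (WL' (v, x.2) Wv).
  have [d0|/eqP d0] := eqVneq (x - (v, x.2)) 0.
    by move/eqP: d0; rewrite subr_eq0 => /eqP ->.
  have := L'neg _ L'd d0; rewrite sform_selfN ltcR (kformE ipP) /= subrr.
  by rewrite (rnm0 ipP.1) expr0n subr0 oppr_gt0 ltNge sqr_ge0.
- exists ((1 - cabs l) / 2)%:C%C; split; first by rewrite ltcR.
  move=> x Wx; rewrite (hnormE ip2P.1) sform_selfN -rmorphXn -rmorphM lecR.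
  exact: Wneg_energy.
Qed.

Lemma Wneg_orthE l y : cabs l < 1 ->
  Wneg l^* y <-> s_orth_in (sform ip) Bmodel (Wpos l) y.
Proof.
move=> l1; split=> [Wy|[By hy]].
  split; first exact: Wneg_B Wy.
  apply/(kform_orthE ipP _ (Wpos_subspace l)) => b Wb; exact: Wpos_Wneg_orth Wb Wy.
exact/(Wneg_dual l1 By)/(kform_orthE ipP _ (Wpos_subspace l)).
Qed.

(** If k q q > 0, adjoining q keeps [L] positive definite, so maximality puts q in [L]; being
    orthogonal to [L], it would then have k q q = 0. *)
Lemma maximal_complement_nonpos (L : HH -> Prop) :
  W_plus (ip2 ip) (sform ip) Bmodel L ->
  forall q, s_orth_in (sform ip) Bmodel L q -> k q q <= 0.
Proof.
move=> [[LP _] LB Lpos Lmax _] q [Bq /(kform_orthE ipP _ LP) hq].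
rewrite leNgt; apply/negP => q0.
have Lk p : L p -> p <> 0 -> 0 < k p p.
  by move=> Lp /(Lpos _ Lp); rewrite (sform_self ipP) ltcR.
pose L' (x : HH) := exists p a, L p /\ x = p + a *: q.
suff /hq h : L q by rewrite h ltxx in q0.
apply: (Lmax L').
- split; first by exists 0, 0; rewrite scale0r addr0; split=> //; apply: LP.1.
  move=> a _ _ [p [t [Lp ->]]] [p' [t' [Lp' ->]]].
  exists (a *: p + p'), (a * t + t'); split; first exact: LP.2.
  by rewrite scalerDr scalerDl scalerA addrACA.
- move=> _ [p [a [Lp ->]]]; apply: (subspaceD Bmodel_subspace); first exact: LB.
  exact: (subspaceZ Bmodel_subspace).
- by move=> p Lp; exists p, 0; rewrite scale0r addr0.
- move=> _ [p [a [Lp ->]]] x0; rewrite (sform_self ipP) ltcR.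
  rewrite !(rformDl kP) !(rformDr kP) kform_scale kform_adj.
  have Lap := subspaceZ LP a^* Lp; rewrite (rformC kP q) hq//.
  have -> : k p (a *: q) = 0.
    by rewrite -[a]conjCK -kform_adj hq.
  rewrite addr0 add0r.
  have [p0|/eqP p0] := eqVneq p 0; last first.
    by rewrite ltr_pwDl ?Lk// mulr_ge0 ?sqr_ge0// ltW.
  rewrite p0 /kform /= !(rip0l ipP.1) subrr add0r mulr_gt0// exprn_gt0//.
  rewrite lt0r cabs_ge0 andbT; apply/negP => /eqP a0; apply: x0.
  have -> : a = 0 by apply/eqP; rewrite -normr_eq0 norm_cabs a0.
  by rewrite p0 scale0r addr0.
- by exists 0, 1; rewrite scale1r add0r; split=> //; apply: LP.1.
Qed.

End Model.

Arguments Bmodel {R H} V S.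
Arguments Wpos {R H} V S.
Arguments Wneg {R H} V S.

(** * Holomorphy relative to an arbitrary base point *)

Section Holomorphy.
Context {R : realType} {H : lmodType R[i]} {ip : H -> H -> R[i]}.
Hypothesis ipP : is_hilbert ip.
Local Notation HH := (H * H)%type.
Local Notation N := (rnm (ip2 ip)).
Local Notation k := (kform ip).
Let ip2P : is_hilbert (ip2 ip) := ip2_hilbert ipP.
Let kP : real_form k := kform_real_form ipP.

Context {V S : H -> H}.
Hypothesis VS : partial_isometry ip V S.
Let SV : partial_isometry ip S V := partial_isometryC ipP VS.
Local Notation B := (Bmodel V S).

(** On the disc of radius rho, halfway between |l0| and 1, energy constants and resolvents are
    controlled uniformly. *)
Lemma disc_local (l0 : R[i]) : cabs l0 < 1 -> exists2 rho : R, 0 <= rho < 1 &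
  exists2 del, 0 < del & cabs l0 <= rho /\
    forall l, cabs (l - l0) < del -> cabs l <= rho.
Proof.
move=> l01; have l00 := cabs_ge0 l0; exists ((1 + cabs l0) / 2).
  by apply/andP; split; lra.
exists ((1 - cabs l0) / 2); first lra.
split=> [|l hl]; first lra.
by have := cabsD (l - l0) l0; rewrite subrK; lra.
Qed.

Context {L : HH -> Prop}.
Hypothesis LW : W_plus (ip2 ip) (sform ip) B L.
Local Notation M := (s_orth_in (sform ip) B L).

Lemma complement_subspace : lin_subspace M.
Proof.
have LP : lin_subspace L by case: LW => -[].
have BP := Bmodel_subspace VS.
split.
  split; first exact: BP.1.
  apply/(kform_orthE ipP _ LP) => b _.
  by rewrite (rformC kP) /kform !(rip0l ipP.1) subrr.
move=> a x y [Bx /(kform_orthE ipP _ LP) hx] [By /(kform_orthE ipP _ LP) hy].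
split; first exact: BP.2.
apply/(kform_orthE ipP _ LP) => b Lb; rewrite (rformDr kP) hy// addr0.
by rewrite -[a]conjCK -(kform_adj ipP) hx//; apply: subspaceZ.
Qed.

Lemma complement_projection : exists (P : HH -> HH) (c : R),
  [/\ linear P, 0 < c, (forall x, N (P x) <= c^-1 * N x),
      (forall x, L x -> c * N x ^+ 2 <= k x x) &
   [/\ (forall x, L (P x)) & (forall x, B x -> M (x - P x))]].
Proof.
have [Lcl LB _ _ [_ [/pos_real[c c0 ->] hc]]] := LW.
have {}hc x : L x -> c * N x ^+ 2 <= k x x.
  by move=> /hc; rewrite (hnormE ip2P.1) (sform_self ipP) -rmorphXn -rmorphM lecR.
have [P [Plin PL Pk Puniq Pb]] :=
  form_projection ip2P Lcl kP (kform_adj ipP) (kform_bound ipP) c0 hc.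
exists P, c; split=> //; split=> // x Bx; split.
  by apply: (subspaceB (Bmodel_subspace VS)) => //; apply: LB.
  by apply/(kform_orthE ipP _ Lcl.1) => b Lb; apply: Pk.
Qed.

Lemma kform_complement x y : L x -> M y -> k x y = 0.
Proof.
have LP : lin_subspace L by case: LW => -[].
by move=> Lx [_ /(kform_orthE ipP _ LP)]; apply.
Qed.

Lemma Wpos_holomorphic :
  holomorphic_param (ip2 ip) L M (Wpos V S) (@open_disc R).
Proof.
have [P [c [Plin c0 Pb hc [PL PM]]]] := complement_projection.
have [Z [Zlin ZS Zstep Zb]] := transfer_difference ipP VS.
have [Lcl LB _ _ _] := LW.
have dE l : open_disc l -> cabs l < 1 by move/open_discE.
(* The displacement is purely in the second component, since these subspaces are graphs over the
   first. *)
apply: (@graph_holomorphic R HH (ip2 ip) ip2P k B L M P c^-1 kP (kform_bound ipP)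
  (Bmodel_subspace VS) Lcl.1 Plin Pb _ PM kform_complement
  (maximal_complement_nonpos ipP VS LW) (@open_disc R) (Wpos V S)
  (fun l => (1 - cabs l) / 2)
  (fun l l0 w => (0, Z l l0 w.1))).
- by move=> x _.
- by move=> l /dE; apply: (Wpos_closed ipP VS).
- by move=> l _; apply: (Wpos_B VS).
- by move=> l /dE l1; rewrite divr_gt0// subr_gt0.
- by move=> l /dE l1; apply: (Wpos_energy ipP VS l1).
- move=> l /dE l1 e Le he.
  (* A vector of [L] orthogonal to the positive subspace lies in a negative one, so the form has
     both signs on it. *)
  have We := Wneg_dual ipP VS l1 (LB _ Le) he.
  have l1' : cabs l^* < 1 by rewrite cabsJ.
  have [//|/eqP e0] := eqVneq e 0.
  have c1 : 0 < (1 - cabs l^*) / 2 by rewrite divr_gt0// subr_gt0.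
  have := addr_gt0 (energy_gt0 ipP c0 (hc _ Le) e0)
    (energy_gt0 ipP c1 (Wneg_energy ipP VS l1' We) e0).
  by rewrite subrr ltxx.
- move=> l l0 /dE l1 /dE l01 a x y; have := Zlin _ _ l1 l01 a x.1 y.1 => /= ->.
  by rewrite [RHS]surjective_pairing /= scaler0 addr0.
- by move=> l l0 _ _ w _; split; rewrite /= ?ZS//; case: VS => Vlin *; exact: lin0.
- move=> l l0 /dE l1 /dE l01 w Ww; rewrite /Wpos /= scaler0 addr0.
  exact: Zstep.
move=> l0 /dE l01; have [rho /andP[r0 r1] [del del0 [l0r lr]]] := disc_local l01.
have [K K0 hK] := Zb rho r0 r1.
have Nsnd v : N (0, v) = rnm ip v by rewrite /rnm rip2E /= (rip0l ipP.1) add0r.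
exists del, ((1 - rho) / 2), K; split=> //; first by rewrite divr_gt0// subr_gt0.
move=> l /dE l1 /lr lrho; have hZ := hK l l0 lrho l0r; split.
- by rewrite ler_pM2r ?invr_gt0// lerD2l lerN2.
- move=> w _; rewrite Nsnd; apply: le_trans (hZ w.1).1 _.
  by rewrite ler_wpM2l// rnm_fst.
- move=> w _.
  have -> : (0, Z l l0 w.1) - (0, Z l0 l0 w.1) =
      (0, Z l l0 w.1 - Z l0 l0 w.1) :> HH.
    by rewrite [LHS]surjective_pairing /= subrr.
  rewrite Nsnd; apply: le_trans (hZ w.1).2 _.
  by rewrite ler_wpM2l ?mulr_ge0 ?cabs_ge0// rnm_fst.
Qed.

(** The same scheme with the form -k, with [L] and [M] exchanged and with the complementary
    projection. *)
Lemma Wneg_holomorphic :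
  holomorphic_param (ip2 ip) M L (Wneg V S) (@open_disc R).
Proof.
have [P [c [Plin c0 Pb hc [PL PM]]]] := complement_projection.
have [Z [Zlin ZV Zstep Zb]] := transfer_difference ipP SV.
have [Lcl LB _ _ _] := LW.
have dE l : open_disc l -> cabs l < 1 by move/open_discE.
have MB : subset_of M B by move=> x [].
apply: (@graph_holomorphic R HH (ip2 ip) ip2P (fun x y => - k x y) B M L
  (fun x => x - P x) (1 + c^-1) _ _ (Bmodel_subspace VS) complement_subspace
  _ _ PM _ _ _ (@open_disc R) (Wneg V S) (fun l => (1 - cabs l) / 2)
  (fun l l0 w => (Z l l0 w.2, 0))).
- exact: real_formN.
- by move=> x y; rewrite normrN kform_bound.
- by move=> a x y; rewrite Plin scalerBr opprD addrACA.
- by move=> x; apply: le_trans (rnmB ip2P.1 _ _) _; rewrite mulrDl mul1r lerD2l Pb.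
- by move=> x _; rewrite opprB addrC subrK.
- by move=> x y Mx Ly; rewrite (rformC kP) kform_complement// oppr0.
- move=> x Lx; rewrite oppr_le0; apply: le_trans (hc _ Lx).
  by rewrite mulr_ge0 ?sqr_ge0// ltW.
- by move=> l /dE; apply: (Wneg_closed ipP VS).
- by move=> l _; apply: (Wneg_B ipP VS).
- by move=> l /dE l1; rewrite divr_gt0// subr_gt0.
- by move=> l /dE l1; apply: (Wneg_energy ipP VS l1).
- move=> l /dE l1 e Me he.
  (* By duality e lies in a uniformly positive subspace, against the nonpositivity of the form on
     [M]. *)
  have We : Wpos V S l^* e.
    apply: (Wpos_dual ipP VS l1 (MB _ Me)) => w /he /eqP.
    by rewrite oppr_eq0 => /eqP.
  have l1' : cabs l^* < 1 by rewrite cabsJ.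
  have [//|/eqP e0] := eqVneq e 0.
  have c1 : 0 < (1 - cabs l^*) / 2 by rewrite divr_gt0// subr_gt0.
  have := lt_le_trans (energy_gt0 ipP c1 (Wpos_energy ipP VS l1' We) e0)
    (maximal_complement_nonpos ipP VS LW Me).
  by rewrite ltxx.
- move=> l l0 /dE l1 /dE l01 a x y; have := Zlin _ _ l1 l01 a x.2 y.2 => /= ->.
  by rewrite [RHS]surjective_pairing /= scaler0 addr0.
- by move=> l l0 _ _ w _; split; rewrite /= ?ZV//; case: VS => _ Slin *; exact: lin0.
- move=> l l0 /dE l1 /dE l01 w Ww; rewrite /Wneg /= scaler0 addr0.
  exact: Zstep.
move=> l0 /dE l01; have [rho /andP[r0 r1] [del del0 [l0r lr]]] := disc_local l01.
have [K K0 hK] := Zb rho r0 r1.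
have Nfst u : N (u, 0) = rnm ip u by rewrite /rnm rip2E /= (rip0l ipP.1) addr0.
exists del, ((1 - rho) / 2), K; split=> //; first by rewrite divr_gt0// subr_gt0.
move=> l /dE l1 /lr lrho; have hZ := hK l l0 lrho l0r; split.
- by rewrite ler_pM2r ?invr_gt0// lerD2l lerN2.
- move=> w _; rewrite Nfst; apply: le_trans (hZ w.2).1 _.
  by rewrite ler_wpM2l// rnm_snd.
- move=> w _.
  have -> : (Z l l0 w.2, 0) - (Z l0 l0 w.2, 0) =
      (Z l l0 w.2 - Z l0 l0 w.2, 0) :> HH.
    by rewrite [LHS]surjective_pairing /= subrr.
  rewrite Nfst; apply: le_trans (hZ w.2).2 _.
  by rewrite ler_wpM2l ?mulr_ge0 ?cabs_ge0// rnm_snd.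
Qed.

End Holomorphy.

(** * From the contraction to the partial isometry *)

Section Contraction.
Context {R : realType} {H : lmodType R[i]} {ip : H -> H -> R[i]} {T Ts : H -> H}.
Hypotheses (ipP : is_hilbert ip) (Tlin : linear T).
Hypotheses (adjT : is_adjoint ip T Ts) (T1 : contraction ip T).
Local Notation HH := (H * H)%type.
Local Notation N := (rnm ip).
Local Notation r := (rip ip).
Let innP : is_inner ip := ipP.1.
Let innP2 : is_inner (ip2 ip) := (ip2_hilbert ipP).1.

Lemma rip_adjoint x y : r (T x) y = r x (Ts y).
Proof. by rewrite /rip adjT. Qed.

Lemma adjoint_linear : linear Ts.
Proof.
move=> a y z; apply: (rip_inj ipP) => x.
rewrite -rip_adjoint !(ripDr innP); congr (_ + _); last exact: rip_adjoint.
by rewrite -[a]conjCK -!(rip_adj innP) -(linZ Tlin) rip_adjoint.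
Qed.

Lemma T_le x : N (T x) <= N x.
Proof. by have := T1 x; rewrite !(hnormE innP) lecR. Qed.

Lemma Ts_le y : N (Ts y) <= N y.
Proof.
have [->|/eqP y0] := eqVneq (Ts y) 0; first by rewrite (rnm0 innP) rnm_ge0.
rewrite -(ler_pM2l (rnm_gt0 innP y0)) -expr2 (rnm_sqr innP) -rip_adjoint.
apply: le_trans (cauchy_schwarz innP _ _) _.
by rewrite ler_wpM2r ?rnm_ge0// T_le.
Qed.

Lemma kerKE x : kerK T Ts x <-> Ts (T x) = x.
Proof.
split=> [/eqP|]; first by rewrite subr_eq0 => /eqP.
by rewrite /kerK => ->; rewrite subrr.
Qed.

Lemma kerK_closed : closed_subspace ip (kerK T Ts).
Proof.
have Tslin := adjoint_linear.
have fP : linear (fun x => x - Ts (T x)).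
  by move=> a x y; rewrite Tlin Tslin scalerBr opprD addrACA.
split.
  split; first exact: (lin0 fP).
  by move=> a x y hx hy; rewrite /kerK fP hx hy scaler0 addr0.
move=> u l Ku ul; apply: (rnm_eq0 innP); apply/le_anti; rewrite rnm_ge0 andbT.
apply: (limit_bound ipP ul (ler0n _ 2)) => n.
have -> : l - Ts (T l) = (l - u n) - Ts (T (l - u n)).
  by have /= -> := linB fP l (u n); rewrite (Ku n) subr0.
apply: le_trans (rnmB innP _ _) _; rewrite (rnmB_sym innP (u n)).
by rewrite mulr_natl mulr2n lerD2l; apply: le_trans (Ts_le _) (T_le _).
Qed.

(* [V = T P] and [S = P T^*] for the orthogonal projection [P] onto [K]. *)
Lemma kerK_partial_isometry : exists V S : H -> H,
  [/\ partial_isometry ip V S,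
      (forall y, kerK T Ts (S y)), (forall x, kerK T Ts x -> V x = T x) &
      (forall x, kerK T Ts x -> S (V x) = x)].
Proof.
have Tslin := adjoint_linear.
have rP : real_form r.
  split=> [x y|y]; first exact: (ripC innP).
  by split=> [x z|a x]; rewrite ?(ripDl innP) ?(ripZ innP).
have [||P [Plin PK Portho Puniq _]] :=
  @form_projection R H ip ipP (kerK T Ts) r 1 kerK_closed rP (rip_adj innP) _ ltr01.
- by move=> x y; rewrite mul1r (cauchy_schwarz_norm innP).
- by move=> x _; rewrite mul1r (rnm_sqr innP).
have Pid x : kerK T Ts x -> P x = x.
  by move=> Kx; apply: Puniq => // y _; rewrite subrr (rip0r innP).
have Psym x y : r (P x) y = r x (P y).
  have h1 := Portho _ y (PK x); have h2 := Portho _ x (PK y).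
  move: h1 h2; rewrite !(ripBr innP) (ripC innP (P y) x) (ripC innP (P y) (P x)).
  by move/eqP; rewrite subr_eq0 => /eqP -> /eqP; rewrite subr_eq0 => /eqP ->.
exists (T \o P), (P \o Ts); split=> /=.
- split=> [a x y|a x y|x y|x|x] /=.
  + by rewrite Plin Tlin.
  + by rewrite Tslin Plin.
  + by rewrite rip_adjoint Psym.
  (* The composite of [T] and its adjoint is the identity on K, the range of [P]. *)
  + by rewrite (Pid (P _)) ?PK// ((kerKE _).1 (PK x)) (Pid _ (PK x)).
  + by rewrite (Pid (P _)) ?PK// ((kerKE _).1 (PK _)) (Pid _ (PK _)).
- by move=> y; apply: PK.
- by move=> x Kx; rewrite Pid.
- by move=> x Kx; rewrite (Pid _ Kx) ((kerKE _).1 Kx) Pid.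
Qed.

Context {V S : H -> H}.
Hypothesis VS : partial_isometry ip V S.
Hypotheses (SK : forall y, kerK T Ts (S y)) (VK : forall x, kerK T Ts x -> V x = T x).
Hypothesis SVK : forall x, kerK T Ts x -> S (V x) = x.
Let SV : partial_isometry ip S V := partial_isometryC ipP VS.
Let Vlin : linear V. Proof. by case: VS. Qed.
Let Slin : linear S. Proof. by case: VS. Qed.
Let adj x y : r (V x) y = r x (S y). Proof. by case: VS. Qed.
Let adj' x y : r (S x) y = r x (V y). Proof. by case: SV. Qed.
Let VSV x : V (S (V x)) = V x. Proof. by case: VS. Qed.
Let SVS x : S (V (S x)) = S x. Proof. by case: VS. Qed.

(** S maps onto K because S V is the identity there. With z free in H, orthogonality to [A_T]
    becomes a vector equation once S and V are moved across. *)
Lemma A_TE a : A_T T Ts a <-> exists z, a = (S z, V (S z)).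
Proof.
split=> [[x [Kx ->]]|[z ->]]; first by exists (V x); rewrite SVK// VK.
by exists (S z); rewrite VK.
Qed.

Lemma A_T_subspace : lin_subspace (A_T T Ts).
Proof.
split; first by apply/A_TE; exists 0; rewrite (lin0 Slin) (lin0 Vlin).
move=> a _ _ /A_TE[z ->] /A_TE[z' ->]; apply/A_TE; exists (a *: z + z').
by rewrite Slin Vlin.
Qed.

Lemma As_TE a : As_T ip T Ts a <-> V a.1 = V (S a.2).
Proof.
transitivity (forall z, rip ip z (V a.1) = rip ip z (V (S a.2))).
  split=> [[_ /(kform_orthE ipP _ A_T_subspace) h] z|h].
    have /h : A_T T Ts (S z, V (S z)) by apply/A_TE; exists z.
    by rewrite /kform /= adj' adj adj' => /eqP; rewrite subr_eq0 => /eqP.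
  split=> //; apply/(kform_orthE ipP _ A_T_subspace) => _ /A_TE[z ->].
  by rewrite /kform /= adj' adj adj' h subrr.
by split=> [/(rip_inj ipP)|->].
Qed.

(** Symplectic orthogonality gives V a.1 = V S a.2, Hilbert orthogonality gives V a.1 = - V S a.2,
    so both vanish. *)
Lemma B_TE a : B_T ip T Ts a <-> Bmodel V S a.
Proof.
split=> [[/As_TE h1 h2]|[Va Sa]].
  have h3 : V a.1 + V (S a.2) = 0.
    apply: (rip_inj ipP) => z; rewrite (rip0r innP).
    have /((ip_orthE A_T_subspace a innP2).1 h2) : A_T T Ts (S z, V (S z)).
      by apply/A_TE; exists z.
    by rewrite rip2E /= adj' adj adj' -(ripDr innP).
  have Va : V a.1 = 0.
    by move/eqP: h3; rewrite -h1 -mulr2n -scaler_nat scaler_eq0 pnatr_eq0 => /eqP.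
  by split=> //; rewrite -SVS -h1 Va (lin0 Slin).
split; first by apply/As_TE; rewrite Va Sa (lin0 Vlin).
apply/(ip_orthE A_T_subspace a innP2) => _ /A_TE[z ->].
by rewrite rip2E /= adj' adj adj' Va Sa (lin0 Vlin) !(rip0r innP) addr0.
Qed.

(** Origin of the transfer graph: the representative of the class of (x, l x) is obtained by
    subtracting (S z, V S z) with S z = l S x. *)
Lemma W_T_plusE l a : W_T_plus ip T Ts l a <-> Wpos V S l a.
Proof.
split=> [[/B_TE[Va Sa] [_ [[[x ->] /As_TE/= Vx] /A_TE[z]]]]|Wa].
  case: a Va Sa => a1 a2 /= Va Sa [e1 e2].
  rewrite (linZ Slin) (linZ Vlin) in Vx.
  have Sz : S z = l *: S x.
    by rewrite -SVS -e1 (linB Vlin) Va subr0 Vx (linZ Slin) SVS.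
  split=> //; exists x; rewrite /= -Sz; split; first by rewrite -e1 opprB addrC subrK.
  by rewrite scalerBr -(linZ Vlin) -Sz -e2 opprB addrC subrK.
have [Va [x [a1 a2]]] := Wa; split; first by apply/B_TE; apply: (Wpos_B VS) Wa.
exists (x, l *: x); split.
  split; first by exists x.
  apply/As_TE; rewrite /= (linZ Slin); move/eqP: Va.
  by rewrite a1 (linB Vlin) subr_eq0 => /eqP.
apply/A_TE; exists (l *: x); rewrite [LHS]surjective_pairing /= a1 a2.
by rewrite scalerBr !opprB !(linZ Slin, linZ Vlin) ![_ + (_ - _)]addrC !subrK.
Qed.

(** Here the element subtracted from (l x, x) has S z = S x, and membership in the symplectic
    complement gives S x = l S V x. *)
Lemma W_T_minusE l a : W_T_minus ip T Ts l a <-> Wneg V S l a.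
Proof.
split=> [[/B_TE[Va Sa] [_ [[[x ->] /As_TE/= Vx] /A_TE[z]]]]|Wa].
  case: a Va Sa => a1 a2 /= Va Sa [e1 e2].
  have Sz : S z = S x.
    by rewrite -SVS -e2 (linB Slin) Sa subr0.
  have SVx : S x = l *: S (V x) by rewrite -SVS -Vx !(linZ Vlin, linZ Slin).
  split=> //; exists x; split.
    by rewrite -(linZ Vlin) Vx -Sz -e2 opprB addrC subrK.
  by rewrite scalerBr -SVx -Sz -e1 opprB addrC subrK.
have [Sa [x [a2 a1]]] := Wa; split; first by apply/B_TE; apply: (Wneg_B ipP VS) Wa.
have Sx : S x = l *: S (V x).
  by move/eqP: Sa; rewrite a2 (linB Slin) (linZ Slin) subr_eq0 => /eqP.
exists (l *: x, x); split.
  split; first by exists x.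
  by apply/As_TE; rewrite /= Sx !(linZ Vlin) VSV.
apply/A_TE; exists x; rewrite [LHS]surjective_pairing /= a1 a2.
by rewrite scalerBr !opprB ![_ + (_ - _)]addrC !subrK Sx (linZ Vlin) VSV.
Qed.

End Contraction.

Theorem theorem4p5 (R : realType) (H : lmodType R[i]) (ip : H -> H -> R[i])
  (T Ts : H -> H) :
  is_hilbert ip -> separable ip -> infinite_dim H ->
  bounded_linear ip T -> is_adjoint ip T Ts -> contraction ip T ->
  completely_non_unitary ip T ->
  [/\ (forall l : R[i], open_disc l ->
         W_plus (ip2 ip) (sform ip) (B_T ip T Ts) (W_T_plus ip T Ts l)),
      (forall l : R[i], open_disc l ->
         W_minus (ip2 ip) (sform ip) (B_T ip T Ts) (W_T_minus ip T Ts l)),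
      (forall L0 : (H * H)%type -> Prop,
         W_plus (ip2 ip) (sform ip) (B_T ip T Ts) L0 ->
         holomorphic_param (ip2 ip) L0
           (s_orth_in (sform ip) (B_T ip T Ts) L0)
           (W_T_plus ip T Ts) (@open_disc R) /\
         holomorphic_param (ip2 ip)
           (s_orth_in (sform ip) (B_T ip T Ts) L0) L0
           (W_T_minus ip T Ts) (@open_disc R)) &
      (forall l : R[i], open_disc l -> forall y : (H * H)%type,
         W_T_minus ip T Ts (l^*) y <->
         s_orth_in (sform ip) (B_T ip T Ts) (W_T_plus ip T Ts l) y)].
Proof.
move=> ipP _ _ [Tlin _] adjT T1 _.
have [V [S [VS SK VK SVK]]] := kerK_partial_isometry ipP Tlin adjT T1.
have -> : B_T ip T Ts = Bmodel V S.
  by apply/funext => a; apply/propext; exact: (B_TE ipP VS SK VK SVK).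
have -> : W_T_plus ip T Ts = Wpos V S.
  apply/funext => l; apply/funext => a; apply/propext.
  exact: (W_T_plusE ipP VS SK VK SVK).
have -> : W_T_minus ip T Ts = Wneg V S.
  apply/funext => l; apply/funext => a; apply/propext.
  exact: (W_T_minusE ipP VS SK VK SVK).
split.
- by move=> l /open_discE; exact: Wpos_W_plus.
- by move=> l /open_discE; exact: Wneg_W_minus.
- by move=> L0 L0W; split; [exact: Wpos_holomorphic | exact: Wneg_holomorphic].
- by move=> l /open_discE l1 y; exact: Wneg_orthE.
Qed.
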